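(* Given an instance $(N,(\succeq_i)_{i\in N},A,L)$ of gGASP with $|N|=n$, $|A|=p+1$, such that the number of non-empty connected subsets of $(N,L)$ is $\kappa$, one can decide in time $O(\kappa^p)\cdot\mathrm{poly}(n,p)$ whether this instance admits a core stable assignment, and find one such assignment if it exists.
   Context: An instance of the group activity selection problem with graph structure (gGASP) consists of: a finite set of players $N=\{1,\dots,n\}$; a finite set of activities $A=A^*\cup\{a_\emptyset\}$, where $A^*=\{a_1,\dots,a_p\}$ is the set of $p$ non-void activities and $a_\emptyset\notin A^*$ is the void activity; for each player $i$ a complete and transitive preference relation $\succeq_i$ on the set of alternatives $(A^*\times\{1,\dots,n\})\cup\{(a_\emptyset,1)\}$, with strict part $\succ_i$; and a set $L$ of edges making $(N,L)$ an undirected graph. It is assumed that two alternatives can be compared under $\succeq_i$ in unit time. An assignment is a map $\pi:N\to A$. For $a\in A^*$ let $\pi^a=\{i\in N:\pi(i)=a\}$; let $\pi_i=\{j\in N:\pi(j)=\pi(i)\}$ if $\pi(i)\ne a_\emptyset$, and $\pi_i=\{i\}$ if $\pi(i)=a_\emptyset$. A coalition $S\subseteq N$ is feasible if it is connected in $(N,L)$ (i.e., the induced subgraph is connected); $\pi$ is feasible if $\pi_i$ is feasible for every $i\in N$. Outcomes of gGASP are feasible assignments. $\pi$ is individually rational if $(\pi(i),|\pi_i|)\succeq_i(a_\emptyset,1)$ for every $i\in N$. A coalition $S\subseteq N$ and activity $a\in A^*$ strongly block $\pi$ if $\pi^a\subseteq S$ and $(a,|S|)\succ_i(\pi(i),|\pi_i|)$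 for all $i\in S$. A core stable assignment is a feasible assignment that is individually rational and for which there is no nonempty connected coalition $S$ and activity $a\in A^*$ that strongly block it. *)

(* Defs.v *)
From HB Require Import structures.
From mathcomp Require Import all_boot.

Set Implicit Arguments.
Unset Strict Implicit.
Unset Printing Implicit Defensive.

(** * Group activity selection on graphs *)

(* [None] is the void activity, [Some a] the non-void activity [a]. *)
Definition activity (p : nat) := option 'I_p.

(* Alternatives are pairs (activity, group size); sizes are plain naturals, and
   this predicate cuts out (A^* x {1..n}) + {(void, 1)}. *)
Definition alternative (n p : nat) : pred (activity p * nat) :=
  fun x => if x.1 is Some _ then 1 <= x.2 <= n else x.2 == 1.
Arguments alternative n p : clear implicits.

Record gGASP (n p : nat) := GGASP {
  (* [pref i x y] : player [i] weakly prefers [x] to [y]; its values outside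
     [alternative n p] are irrelevant. *)
  pref : 'I_n -> rel (activity p * nat);
  edge : rel 'I_n;
  pref_total : forall i, {in alternative n p &, total (pref i)};
  pref_trans : forall i, {in alternative n p & &, transitive (pref i)};
  edge_sym : symmetric edge;
  edge_irr : irreflexive edge
}.

Section Model.
Variables (n p : nat) (I : gGASP n p).

Definition sprefers (i : 'I_n) (x y : activity p * nat) : bool :=
  pref I i x y && ~~ pref I i y x.

Definition induced (S : {set 'I_n}) : rel 'I_n :=
  [rel x y | [&& x \in S, y \in S & edge I x y]].

Definition connected (S : {set 'I_n}) : bool :=
  [forall x in S, forall y in S, connect (induced S) x y].

Definition kappa : nat :=
  #|[set S : {set 'I_n} | (S != set0) && connected S]|.

Definition assignment := {ffun 'I_n -> activity p}.

Definition players_of (pi : assignment) (a : 'I_p) : {set 'I_n} :=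
  [set i | pi i == Some a].

Definition coalition (pi : assignment) (i : 'I_n) : {set 'I_n} :=
  if pi i is Some a then players_of pi a else [set i].

Definition outcome (pi : assignment) (i : 'I_n) : activity p * nat :=
  (pi i, #|coalition pi i|).

Definition feasible (pi : assignment) : Prop :=
  forall i, connected (coalition pi i).

Definition individually_rational (pi : assignment) : Prop :=
  forall i, pref I i (outcome pi i) (None, 1).

Definition strongly_blocks (S : {set 'I_n}) (a : 'I_p) (pi : assignment) :
    Prop :=
  players_of pi a \subset S /\
  (forall i, i \in S -> sprefers i (Some a, #|S|) (outcome pi i)).

Definition core_stable (pi : assignment) : Prop :=
  [/\ feasible pi,
      individually_rational pi &
      ~ exists (S : {set 'I_n}) (a : 'I_p),
          [/\ S != set0, connected S & strongly_blocks S a pi]].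

End Model.

(** * Random access machine with access to an instance *)

(* Programs are structured programs of a successor RAM. The store has registers
   and arrays of natural numbers, both named by naturals; a program mentions
   only finitely many names. Every operation has unit cost. The only arithmetic
   is +1 and -1, so that after t steps no value exceeds t plus the input values
   and the constants of the program: no work can be hidden in arithmetic on long
   numbers, as would be possible with unit-cost addition or multiplication. *)
Inductive expr : Type :=
| EConst of nat
| EReg of nat
| EGet of nat & expr                              (* array cell a[e] *)
| ESucc of expr
| EPred of expr
| EEq of expr & expr
| ELt of expr & expr
| EEdge of expr & expr                            (* is {i, j} an edge? *)
| EPref of expr & expr & expr & expr & expr.
  (* [EPref i a k b l] : does player i weakly prefer (a, k) to (b, l)? *)

Inductive cmd : Type :=
| CSkip
| CSet of nat & expr                              (* register x := e *)
| CPut of nat & expr & expr                       (* a[e1] := e2 *)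
| CSeq of cmd & cmd
| CIf of expr & cmd & cmd                         (* nonzero means true *)
| CWhile of expr & cmd.

Record store := Store {
  reg : nat -> nat;
  arr : nat -> nat -> nat
}.

Definition set_reg (s : store) (x v : nat) : store :=
  Store (fun y => if y == x then v else reg s y) (arr s).

Definition set_arr (s : store) (a i v : nat) : store :=
  Store (reg s)
        (fun b j => if (b == a) && (j == i) then v else arr s b j).

(* Players are coded by 0, ..., n-1, the void activity by 0, and the non-void
   activities by 1, ..., p. Group sizes are represented by themselves. *)
Definition code (p : nat) (a : activity p) : nat :=
  if a is Some j then j.+1 else 0.

Section Machine.
Variables (n p : nat) (I : gGASP n p).

(* Queries whose arguments code no players or no alternatives get answer 0. *)
Definition edge_query (i j : nat) : bool :=
  [exists x : 'I_n, exists y : 'I_n,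
     [&& val x == i, val y == j & edge I x y]].

Definition pref_query (i a k b l : nat) : bool :=
  [exists z : 'I_n, exists x : activity p, exists y : activity p,
     [&& val z == i, code x == a, code y == b,
         alternative n p (x, k), alternative n p (y, l) &
         pref I z (x, k) (y, l)]].

Fixpoint eval (s : store) (e : expr) : nat :=
  match e with
  | EConst c => c
  | EReg x => reg s x
  | EGet a e1 => arr s a (eval s e1)
  | ESucc e1 => (eval s e1).+1
  | EPred e1 => (eval s e1).-1
  | EEq e1 e2 => eval s e1 == eval s e2
  | ELt e1 e2 => eval s e1 < eval s e2
  | EEdge e1 e2 => edge_query (eval s e1) (eval s e2)
  | EPref e1 e2 e3 e4 e5 =>
      pref_query (eval s e1) (eval s e2) (eval s e3) (eval s e4) (eval s e5)
  end.

Fixpoint ecost (e : expr) : nat :=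
  match e with
  | EConst _ | EReg _ => 1
  | EGet _ e1 | ESucc e1 | EPred e1 => (ecost e1).+1
  | EEq e1 e2 | ELt e1 e2 | EEdge e1 e2 => (ecost e1 + ecost e2).+1
  | EPref e1 e2 e3 e4 e5 =>
      (ecost e1 + ecost e2 + ecost e3 + ecost e4 + ecost e5).+1
  end.

(* [exec c s t s'] : started in [s], [c] halts in [s'] after [t] steps. *)
Inductive exec : cmd -> store -> nat -> store -> Prop :=
| exec_skip s : exec CSkip s 1 s
| exec_set s x e :
    exec (CSet x e) s (ecost e).+1 (set_reg s x (eval s e))
| exec_put s a e1 e2 :
    exec (CPut a e1 e2) s (ecost e1 + ecost e2).+1
         (set_arr s a (eval s e1) (eval s e2))
| exec_seq c1 c2 s t1 s1 t2 s2 :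
    exec c1 s t1 s1 -> exec c2 s1 t2 s2 -> exec (CSeq c1 c2) s (t1 + t2) s2
| exec_if_true e c1 c2 s t s' :
    eval s e != 0 -> exec c1 s t s' ->
    exec (CIf e c1 c2) s ((ecost e).+1 + t) s'
| exec_if_false e c1 c2 s t s' :
    eval s e = 0 -> exec c2 s t s' ->
    exec (CIf e c1 c2) s ((ecost e).+1 + t) s'
| exec_while_true e c s t1 s1 t2 s2 :
    eval s e != 0 -> exec c s t1 s1 -> exec (CWhile e c) s1 t2 s2 ->
    exec (CWhile e c) s ((ecost e).+1 + t1 + t2) s2
| exec_while_false e c s :
    eval s e = 0 -> exec (CWhile e c) s (ecost e).+1 s.

(* Besides the queries, the input consists of n in register 0 and p in
   register 1. *)
Definition init_store : store :=
  Store (fun x => if x == 0 then n else if x == 1 then p else 0)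
        (fun _ _ => 0).

(* The verdict is left in register 0, and the assignment in array 0. *)
Definition solved (s : store) : Prop :=
  (reg s 0 = 1 /\
     exists pi : assignment n p,
       core_stable I pi /\ forall i : 'I_n, arr s 0 i = code (pi i))
  \/ (reg s 0 = 0 /\ ~ exists pi : assignment n p, core_stable I pi).

Lemma exec_det c s t1 s1 t2 s2 :
  exec c s t1 s1 -> exec c s t2 s2 -> t1 = t2 /\ s1 = s2.
Proof.
move=> H; elim: H t2 s2 => {c s t1 s1}
  [s|s x e|s a e1 e2|c1 c2 s t1 s1 t2 s2 _ IH1 _ IH2|e c1 c2 s t s' es _ IH
  |e c1 c2 s t s' es _ IH|e c s t1 s1 t2 s2 es _ IH1 _ IH2|e c s es] t' s'' H;
inversion H; subst; repeat match goal with
| IH : forall t s, exec ?c ?s0 t s -> _, E : exec ?c ?s0 _ _ |- _ =>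
    have [? ?] := IH _ _ E; subst; clear IH
| E1 : is_true (eval ?s ?e != 0), E2 : eval ?s ?e = 0 |- _ =>
    by rewrite E2 in E1
end; by [].
Qed.

End Machine.

(* Main.v *)
Require Import Defs.
From mathcomp Require Import all_boot zify.

(* Feasible assignments are the leaves of a binary decision tree. Going through
   the activities a in turn, n sweeps over the players ask each player v that
   is still free, has not been rejected for a, and is adjacent to the group of
   a (or may found it) whether v joins a. Rejecting is always possible and every
   answer is remembered, so the leaves are exactly the feasible assignments,
   each occurring once. Replaying the branch of a given leaf in polynomial time
   also yields the next leaf: it is the leftmost one behind the last question
   answered negatively, namely the labels at that moment plus the refused pair.

   Core stability of a leaf is tested in polynomial time: some coalition of size
   k strongly blocks with a iff, among the players who strictly prefer (a, k) to
   their outcome, some connected component contains the group of a and has at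
   least k members, while the group of a has at most k; a connected set can then
   be grown one player at a time to size exactly k.

   There are at most min((kappa+1)^p, (p+1)^n) leaves, with n <= kappa. If
   p <= kappa, the first bound is at most 4 kappa^p. Otherwise the second is at
   most 4 p^n <= 4 p^kappa <= 4 kappa^p as soon as kappa >= 4, and is at most
   (n+p)^3 when kappa <= 3. *)

Set Implicit Arguments.
Unset Strict Implicit.
Unset Printing Implicit Defensive.

(** * Static cost and weakest preconditions *)

(* Every loop is charged for [m] iterations. *)
Fixpoint cost (m : nat) (c : cmd) : nat :=
  match c with
  | CSkip => 1
  | CSet _ e => (ecost e).+1
  | CPut _ e1 e2 => (ecost e1 + ecost e2).+1
  | CSeq c1 c2 => cost m c1 + cost m c2
  | CIf e c1 c2 => (ecost e).+1 + (cost m c1 + cost m c2)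
  | CWhile e c => m * ((ecost e).+1 + cost m c) + (ecost e).+1
  end.

(** Each level of loop nesting contributes one factor [m], and the nesting depth depends on the
    program only. Adding the exponents of two subprograms, instead of taking their maximum, is crude
    but sufficient. *)
Lemma cost_poly c : exists C d, forall m, 0 < m -> cost m c <= C * m ^ d.
Proof.
have mono m i j : 0 < m -> i <= j -> m ^ i <= m ^ j.
  by move=> m0 ij; rewrite leq_pexp2l.
elim: c => [|x e|a e1 e2|c1 [C1 [d1 H1]] c2 [C2 [d2 H2]]
  |e c1 [C1 [d1 H1]] c2 [C2 [d2 H2]]|e c [C [d H]]] /=.
- by exists 1, 0.
- by exists (ecost e).+1, 0 => m _; rewrite muln1.
- by exists (ecost e1 + ecost e2).+1, 0 => m _; rewrite muln1.
- exists (C1 + C2), (d1 + d2) => m m0.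
  have := H1 m m0; have := H2 m m0.
  have := mono m d1 (d1 + d2) m0 (leq_addr _ _).
  have := mono m d2 (d1 + d2) m0 (leq_addl _ _); nia.
- exists ((ecost e).+1 + C1 + C2), (d1 + d2) => m m0.
  have := H1 m m0; have := H2 m m0.
  have := mono m d1 (d1 + d2) m0 (leq_addr _ _).
  have := mono m d2 (d1 + d2) m0 (leq_addl _ _).
  have := mono m 0 (d1 + d2) m0 isT; rewrite expn0; nia.
- exists (2 * (ecost e).+1 + C), d.+1 => m m0.
  have := H m m0; have := mono m 0 d m0 isT; rewrite expn0 expnS.
  nia.
Qed.

(** * Frame conditions read off the syntax *)

Fixpoint written_regs (c : cmd) : seq nat :=
  match c with
  | CSet x _ => [:: x]
  | CSeq c1 c2 | CIf _ c1 c2 => written_regs c1 ++ written_regs c2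
  | CWhile _ c => written_regs c
  | _ => [::]
  end.

Fixpoint written_arrs (c : cmd) : seq nat :=
  match c with
  | CPut a _ _ => [:: a]
  | CSeq c1 c2 | CIf _ c1 c2 => written_arrs c1 ++ written_arrs c2
  | CWhile _ c => written_arrs c
  | _ => [::]
  end.

Definition frame (c : cmd) (s s' : store) : Prop :=
  (forall x, x \notin written_regs c -> reg s' x = reg s x) /\
  (forall a, a \notin written_arrs c -> arr s' a = arr s a).

Lemma frame_refl c s : frame c s s. Proof. by []. Qed.

Lemma frame_trans c s1 s2 s3 : frame c s1 s2 -> frame c s2 s3 -> frame c s1 s3.
Proof.
move=> [r12 a12] [r23 a23]; split=> x xc; first by rewrite r23 ?r12.
by rewrite a23 ?a12.
Qed.

Lemma frame_sub c c' s s' :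
    {subset written_regs c <= written_regs c'} ->
    {subset written_arrs c <= written_arrs c'} ->
  frame c s s' -> frame c' s s'.
Proof.
move=> subr suba [fr fa]; split=> x xc.
  by apply: fr; apply: contra xc; apply: subr.
by apply: fa; apply: contra xc; apply: suba.
Qed.

(** The bound is held in a register, since [n] and [p] are known only at run time. The guard rereads
    it at every iteration, so the rules for loops ask that the body leave both [x] and [b] alone. *)
Definition CFor (x b : nat) (c : cmd) : cmd :=
  CSeq (CSet x (EConst 0))
       (CWhile (ELt (EReg x) (EReg b)) (CSeq c (CSet x (ESucc (EReg x))))).

Definition ENot (e : expr) : expr := EEq e (EConst 0).
(* Correct only if [e2] takes the values 0 and 1. *)
Definition EAnd (e1 e2 : expr) : expr := ELt (ENot e1) e2.

Section WeakestPrecondition.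
Variables (n p : nat) (I : gGASP n p).

Lemma exec_frame c s t s' : exec I c s t s' -> frame c s s'.
Proof.
elim=> {c s t s'}.
- by move=> s; apply: frame_refl.
- by move=> s x e; split=> //= y; rewrite inE => /negPf ->.
- by move=> s a e1 e2; split=> //= b; rewrite inE => /negPf ->.
- move=> c1 c2 s t1 s1 t2 s2 _ f1 _ f2.
  by apply: (@frame_trans _ _ s1);
    [apply: frame_sub f1|apply: frame_sub f2] => x /= xc;
    rewrite mem_cat xc ?orbT.
- by move=> e c1 c2 s t s' _ _; apply: frame_sub => x /= xc; rewrite mem_cat xc.
- move=> e c1 c2 s t s' _ _; apply: frame_sub => x /= xc.
    by rewrite mem_cat xc orbT.
  by rewrite mem_cat xc orbT.
- by move=> e c s t1 s1 t2 s2 _ _ f1 _ f2; apply: frame_trans f1 f2.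
- by move=> e c s _; apply: frame_refl.
Qed.

Lemma eval_and s e1 e2 (b1 b2 : bool) :
  eval I s e1 = b1 -> eval I s e2 = b2 -> eval I s (EAnd e1 e2) = (b1 && b2).
Proof. by move=> /= -> ->; case: b1 b2 => [] []. Qed.

Lemma eval_not s e (b : bool) : eval I s e = b -> eval I s (ENot e) = ~~ b.
Proof. by move=> /= ->; case: b. Qed.

(** Total correctness with a time bound. Charging [n + p] iterations per loop suffices for counted
    loops, whose bounds are [n] or [p]. *)
Definition wp (c : cmd) (s : store) (Q : store -> Prop) : Prop :=
  exists t s', [/\ exec I c s t s', t <= cost (n + p) c & Q s'].

(** The frame is passed on to the new postcondition, so a specification need only mention what a
    command computes; whatever it preserves is recovered here. *)
Lemma wp_conseq (Q' : store -> Prop) c s (Q : store -> Prop) :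
  wp c s Q' -> (forall s', frame c s s' -> Q' s' -> Q s') -> wp c s Q.
Proof.
move=> [t [s' [Hc ct Hq]]] QQ; exists t, s'; split=> //.
by apply: QQ Hq; apply: exec_frame Hc.
Qed.

Lemma wp_skip s (Q : store -> Prop) : Q s -> wp CSkip s Q.
Proof. by move=> q; exists 1, s; split=> //; constructor. Qed.

Lemma wp_set s x e (Q : store -> Prop) :
  Q (set_reg s x (eval I s e)) -> wp (CSet x e) s Q.
Proof.
by move=> q; exists (ecost e).+1, (set_reg s x (eval I s e)); split=> //;
  constructor.
Qed.

Lemma wp_put s a e1 e2 (Q : store -> Prop) :
  Q (set_arr s a (eval I s e1) (eval I s e2)) -> wp (CPut a e1 e2) s Q.
Proof.
by move=> q; exists (ecost e1 + ecost e2).+1,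
  (set_arr s a (eval I s e1) (eval I s e2)); split=> //; constructor.
Qed.

Lemma wp_seq c1 c2 s (Q : store -> Prop) :
  wp c1 s (fun s1 => wp c2 s1 Q) -> wp (CSeq c1 c2) s Q.
Proof.
move=> [t1 [s1 [H1 k1 [t2 [s2 [H2 k2 q]]]]]]; exists (t1 + t2), s2.
by split=> //=; [apply: exec_seq H1 H2|apply: leq_add].
Qed.

Lemma wp_if e c1 c2 s (b : bool) (Q : store -> Prop) :
    eval I s e = b ->
    (b -> wp c1 s Q) -> (~~ b -> wp c2 s Q) ->
  wp (CIf e c1 c2) s Q.
Proof.
case: b => eb q1 q2.
  have [t [s' [H k q]]] := q1 isT; exists ((ecost e).+1 + t), s'.
  split=> //=; last by lia.
  by apply: exec_if_true => //; rewrite eb.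
have [t [s' [H k q]]] := q2 isT; exists ((ecost e).+1 + t), s'.
split=> //=; last by lia.
by apply: exec_if_false.
Qed.

(** The invariant has to survive changes of the counter, which is incremented after the body. The
    body receives the frame from the start of the whole loop, so facts about untouched names need
    not enter the invariant. *)
Lemma wp_for N x b c s (Inv : nat -> store -> Prop) (Q : store -> Prop) :
    x != b -> x \notin written_regs c -> b \notin written_regs c ->
    reg s b = N -> N <= n + p ->
    (forall k s' v, Inv k s' -> Inv k (set_reg s' x v)) ->
    Inv 0 s ->
    (forall (i : 'I_N) s', frame (CFor x b c) s s' -> reg s' x = i ->
       Inv i s' -> wp c s' (Inv i.+1)) ->
    (forall s', frame (CFor x b c) s s' -> Inv N s' -> Q s') ->
  wp (CFor x b c) s Q.
Proof.
move=> xb xc bc sb Nm Ix I0 Istep IQ; apply: wp_seq; apply: wp_set => /=.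
set s0 := set_reg s x 0; set cw := CWhile _ _.
(* Induction on the number [j] of iterations left; 4 is the price of one evaluation of the guard. *)
have loop : forall j k s', k + j = N -> reg s' x = k -> reg s' b = N ->
    frame (CFor x b c) s s' -> Inv k s' ->
    exists t s'', [/\ exec I cw s' t s'',
      t <= j * (4 + cost (n + p) (CSeq c (CSet x (ESucc (EReg x))))) + 4,
      frame (CFor x b c) s s'' & Inv N s''].
  elim=> [|j IHj] k s' kj sx sb' fs Is.
    exists 4, s'; split=> //; last by rewrite -kj addn0.
    by apply: exec_while_false => /=; rewrite sx sb' -kj addn0 ltnn.
  have kN : k < N by rewrite -kj; lia.
  have [t [s1 [Hc ct Is1]]] := Istep (Ordinal kN) s' fs sx Is.
  have [fr fa] := exec_frame Hc.
  have s1x : reg s1 x = k by rewrite fr.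
  have Hb : exec I (CSeq c (CSet x (ESucc (EReg x)))) s' (t + 3)
      (set_reg s1 x k.+1).
    apply: exec_seq Hc _; rewrite -s1x.
    exact: (exec_set I s1 x (ESucc (EReg x))).
  have [|||||t2 [s2 [H2 ct2 f2 I2]]] := IHj k.+1 (set_reg s1 x k.+1).
  - by rewrite addSnnS.
  - by rewrite /= eqxx.
  - by rewrite /= eq_sym (negPf xb) fr.
  - apply: frame_trans fs _; apply: frame_sub (exec_frame Hb) => //= y.
    by rewrite inE => ->; rewrite orbT.
  - by apply: Ix.
  exists (4 + (t + 3) + t2), s2; split=> //.
    by apply: exec_while_true H2 => //=; rewrite sx sb' kN.
  move: ct2 => /=; lia.
have [|||||t [s' [H ct fs Is]]] := loop N 0 s0.
- by [].
- by rewrite /= eqxx.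
- by rewrite /= eq_sym (negPf xb).
- by split=> //= y; rewrite inE negb_or => /andP[/negPf ->].
- exact: Ix.
exists t, s'; split=> //; last exact: IQ.
apply: leq_trans ct _; rewrite /=; nia.
Qed.

(** * Loops as folds over the ordinals *)

Lemma take_enumS N (i : 'I_N) :
  take i.+1 (enum 'I_N) = rcons (take i (enum 'I_N)) i.
Proof.
by rewrite (take_nth i) ?nth_ord_enum // size_enum_ord.
Qed.

Lemma wp_for_fold N (X : Type) (f : X -> 'I_N -> X) (Rep : X -> store -> Prop)
    (x0 : X) x b c s (Q : store -> Prop) :
    x != b -> x \notin written_regs c -> b \notin written_regs c ->
    reg s b = N -> N <= n + p ->
    (forall z s' v, Rep z s' -> Rep z (set_reg s' x v)) ->
    Rep x0 s ->
    (forall (i : 'I_N) z s', frame (CFor x b c) s s' -> reg s' x = i ->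
       Rep z s' -> wp c s' (Rep (f z i))) ->
    (forall s', frame (CFor x b c) s s' -> Rep (foldl f x0 (enum 'I_N)) s' ->
       Q s') ->
  wp (CFor x b c) s Q.
Proof.
move=> xb xc bc sb Nm Rx R0 Rstep RQ.
apply: (@wp_for N _ _ _ _ (fun k => Rep (foldl f x0 (take k (enum 'I_N))))) => //.
- by move=> k s' v; apply: Rx.
- by rewrite take0.
- move=> i s' fs sx Rs; rewrite take_enumS -cats1 foldl_cat /=.
  exact: Rstep.
- by move=> s' fs; rewrite take_oversize ?size_enum_ord //; apply: RQ.
Qed.

Lemma foldl_or (T : Type) (P : pred T) b (s : seq T) :
  foldl (fun z i => z || P i) b s = b || has P s.
Proof. by elim: s b => [|i s IHs] b /=; rewrite ?orbF ?IHs ?orbA. Qed.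

Lemma foldl_or_enum N (P : pred 'I_N) b :
  foldl (fun z i => z || P i) b (enum 'I_N) = b || [exists i, P i].
Proof.
rewrite foldl_or; congr (_ || _); apply/hasP/existsP => [[i _ Pi]|[i Pi]].
  by exists i.
by exists i; rewrite ?mem_enum.
Qed.

Lemma wp_for_or N (P : pred 'I_N) y (b0 : bool) x b c s (Q : store -> Prop) :
    x != b -> x \notin written_regs c -> b \notin written_regs c ->
    reg s b = N -> N <= n + p ->
    y != x -> reg s y = b0 ->
    (forall (i : 'I_N) (z : bool) s', frame (CFor x b c) s s' ->
       reg s' x = i -> reg s' y = z ->
       wp c s' (fun s'' => reg s'' y = z || P i)) ->
    (forall s', frame (CFor x b c) s s' -> reg s' y = b0 || [exists i, P i] ->
       Q s') ->
  wp (CFor x b c) s Q.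
Proof.
move=> xb xc bc sb Nm yx sy step SQ.
apply: (@wp_for_fold N _ (fun z i => z || P i)
  (fun (z : bool) s' => reg s' y = z) b0) => //.
  by move=> z s' v; rewrite /= (negPf yx).
by move=> s' fs; rewrite foldl_or_enum; apply: SQ.
Qed.

Definition CAny (x b y : nat) (e : expr) : cmd :=
  CSeq (CSet y (EConst 0)) (CFor x b (CIf e (CSet y (EConst 1)) CSkip)).

Lemma wp_any N (P : pred 'I_N) x b y e s (Q : store -> Prop) :
    x != b -> y != b -> y != x ->
    reg s b = N -> N <= n + p ->
    (forall (i : 'I_N) s', frame (CAny x b y e) s s' -> reg s' x = i ->
       eval I s' e = P i) ->
    (forall s', frame (CAny x b y e) s s' -> reg s' y = [exists i, P i] ->
       Q s') ->
  wp (CAny x b y e) s Q.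
Proof.
move=> xb yb yx sb Nm ev SQ; apply: wp_seq; apply: wp_set => /=.
set s0 := set_reg s y 0.
have fr s' : frame (CFor x b (CIf e (CSet y (EConst 1)) CSkip)) s0 s' ->
    frame (CAny x b y e) s s'.
  move=> fs; apply: (@frame_trans _ _ s0).
    by split=> //= z; rewrite inE negb_or => /andP[/negPf -> _].
  by apply: frame_sub fs => //= z zc; rewrite inE zc orbT.
apply: (@wp_for_or N P y false) => //.
- by rewrite /= inE eq_sym.
- by rewrite /= inE eq_sym.
- by rewrite /= eq_sym (negPf yb).
- by rewrite /= eqxx.
- move=> i z s' fs sx sy; apply: wp_if (ev i s' (fr _ fs) sx) _ _ => Pi.
    by apply: wp_set; rewrite /= eqxx Pi orbT.
  by apply: wp_skip; rewrite (negPf Pi) orbF.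
- by move=> s' /fr fs; apply: SQ.
Qed.

Definition CCount (x b y : nat) (e : expr) : cmd :=
  CSeq (CSet y (EConst 0))
       (CFor x b (CIf e (CSet y (ESucc (EReg y))) CSkip)).

Lemma wp_count N (P : {set 'I_N}) x b y e s (Q : store -> Prop) :
    x != b -> y != b -> y != x ->
    reg s b = N -> N <= n + p ->
    (forall (i : 'I_N) s', frame (CCount x b y e) s s' -> reg s' x = i ->
       eval I s' e = (i \in P)) ->
    (forall s', frame (CCount x b y e) s s' -> reg s' y = #|P| -> Q s') ->
  wp (CCount x b y e) s Q.
Proof.
move=> xb yb yx sb Nm ev SQ; apply: wp_seq; apply: wp_set => /=.
set s0 := set_reg s y 0; set c := CIf _ _ _.
have fr s' : frame (CFor x b c) s0 s' -> frame (CCount x b y e) s s'.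
  move=> fs; apply: (@frame_trans _ _ s0).
    by split=> //= z; rewrite inE negb_or => /andP[/negPf -> _].
  by apply: frame_sub fs => //= z zc; rewrite inE zc orbT.
apply: (@wp_for_fold N _ (fun k i => k + (i \in P))
  (fun k s' => reg s' y = k) 0) => //.
- by rewrite /= inE eq_sym.
- by rewrite /= inE eq_sym.
- by rewrite /= eq_sym (negPf yb).
- by move=> z s' v; rewrite /= (negPf yx).
- by rewrite /= eqxx.
- move=> i z s' fs sx sy; apply: wp_if (ev i s' (fr _ fs) sx) _ _ => Pi.
    by apply: wp_set; rewrite /= eqxx Pi addn1 sy.
  by apply: wp_skip; rewrite (negPf Pi) addn0.
- move=> s' /fr fs sy; apply: SQ => //; rewrite sy.
  have -> (k : nat) l : foldl (fun k i => k + (i \in P)) k l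
      = k + count (mem P) l.
    by elim: l k => [|i l IHl] k /=; rewrite ?addn0 ?IHl ?addnA.
  by rewrite add0n cardE [enum P]/enum_mem size_filter -enumT.
Qed.

Definition CMap (x b a : nat) (e : expr) : cmd :=
  CFor x b (CPut a (EReg x) e).

Lemma wp_map N (g : 'I_N -> nat) x b a e s (Q : store -> Prop) :
    x != b -> reg s b = N -> N <= n + p ->
    (forall (i : 'I_N) s', frame (CMap x b a e) s s' -> reg s' x = i ->
       eval I s' e = g i) ->
    (forall s', frame (CMap x b a e) s s' ->
       (forall i : 'I_N, arr s' a i = g i) -> Q s') ->
  wp (CMap x b a e) s Q.
Proof.
move=> xb sb Nm ev SQ.
apply: (@wp_for N _ _ _ _ (fun k s' => forall i : 'I_N, i < k ->
  arr s' a i = g i)) => //.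
- move=> i s' fs sx Is; apply: wp_put => /= j; rewrite sx eqxx /= ltnS.
  rewrite leq_eqVlt val_eqE => /predU1P[->|ji]; first by rewrite eqxx (ev i).
  by case: eqP => [E|_]; [move: ji; rewrite E ltnn|apply: Is].
- by move=> s' fs Is; apply: SQ => // i; apply: Is.
Qed.

End WeakestPrecondition.

(** * Counting feasible assignments *)

(* Bernoulli's inequality [(1 - 1/(k+1))^h >= 1 - h/(k+1)], cleared of
   denominators. *)
Lemma bernoulli k h : h <= k.+1 -> k.+1 ^ h * (k.+1 - h) <= k ^ h * k.+1.
Proof.
elim: h => [|h IHh] hk; first by rewrite subn0.
have := IHh (ltnW hk); rewrite !expnS.
set x := k.+1 ^ h; set y := k ^ h; have -> : k.+1 - h = (k.+1 - h.+1).+1 by lia.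
set d := _ - _ => H.
have dk : d <= k by lia.
have : k.+1 * (x * d.+1) <= k.+1 * (y * k.+1) by rewrite leq_mul2l H orbT.
have : k.+1 * d <= k * d.+1 by nia.
nia.
Qed.

(** Split [q] into two halves [h] with [2 * h <= k.+1]. By Bernoulli [(1 - 1/(k+1))^h >= 1/2], so
    each half costs a factor 2. *)
Lemma succ_exp_le k q : q <= k -> k.+1 ^ q <= 4 * k ^ q.
Proof.
have half h : 2 * h <= k.+1 -> k.+1 ^ h <= 2 * k ^ h.
  move=> hk; have := @bernoulli k h ltac:(lia).
  set x := _ ^ h; set y := _ ^ h; nia.
move=> qk.
have -> : q = q./2 + (q - q./2) by lia.
rewrite !expnD; have := @half q./2 ltac:(lia).
have := @half (q - q./2) ltac:(lia); nia.
Qed.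

(** Induction on [q] from [q = k]: passing to [q.+1] multiplies the left side by at most 4, by
    [succ_exp_le], and the right side by [k >= 4]. *)
Lemma exp_swap_le k q : 4 <= k -> k <= q -> q ^ k <= k ^ q.
Proof.
move=> k4; elim: q => [|q IHq]; first by lia.
rewrite leq_eqVlt => /predU1P[->|]; rewrite ?leqnn // ltnS => kq.
have := IHq kq; have := succ_exp_le kq; rewrite (expnS k).
by set x := q.+1 ^ k; set y := q ^ k; set z := k ^ q; nia.
Qed.

Lemma count_le n p k : 0 < n -> n <= k ->
  minn (k.+1 ^ p) (p.+1 ^ n) <= 4 * k ^ p * (n + p) ^ 3.
Proof.
move=> n0 nk; have [pk|kp] := leqP p k.
  apply: leq_trans (geq_minl _ _) _; apply: leq_trans (succ_exp_le pk) _.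
  by rewrite leq_pmulr // expn_gt0; lia.
apply: leq_trans (geq_minr _ _) _; have [k4|k3] := leqP 4 k.
  have np : n <= p by lia.
  apply: leq_trans (succ_exp_le np) _.
  apply: (@leq_trans (4 * k ^ p)).
    rewrite leq_mul2l /=; apply: leq_trans (exp_swap_le k4 (ltnW kp)).
    by rewrite leq_pexp2l //; lia.
  by rewrite leq_pmulr // expn_gt0; lia.
(* Here [n <= k <= 3], so the exponent [n] may be raised to 3, and [p.+1 <= n + p]. *)
apply: (@leq_trans ((n + p) ^ 3)); last first.
  by rewrite leq_pmull // muln_gt0 expn_gt0; lia.
apply: (@leq_trans (p.+1 ^ 3)); first by rewrite leq_pexp2l //; lia.
by rewrite leq_exp2r //; lia.
Qed.

(** * Connected sets *)

Section Connected.
Variables (n p : nat) (I : gGASP n p).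
Implicit Types (S C D P : {set 'I_n}) (u v : 'I_n).

Lemma connect_induced_sym S : connect_sym (induced I S).
Proof.
by apply: sym_connect_sym => x y; rewrite /induced /= (edge_sym I y) andbCA.
Qed.

(** Without such an edge [S] would be closed under the edges inside [C], yet a path in [C] joins a
    member of [S] to a player outside it. *)
Lemma connected_cross C S : connected I C -> S != set0 -> S \proper C ->
  exists u v, [/\ u \in S, v \in C :\: S & edge I u v].
Proof.
move=> /forall_inP Cc /set0Pn[x xS] /properP[SC [y yC yS]].
have [/existsP[u /existsP[v /and3P[]]]|no] :=
  boolP [exists u, exists v, [&& u \in S, v \in C :\: S & edge I u v]].
  by exists u, v.
have clS : closed (induced I C) (mem S).
  have half u v : induced I C u v -> u \in S -> v \in S.
    move=> /and3P[uC vC uv] uS; apply: contraR no => vS.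
    by apply/existsP; exists u; apply/existsP; exists v; rewrite inE uS vS vC.
  move=> u v uv; apply/idP/idP; apply: half => //.
  by move: uv => /and3P[uC vC uv]; apply/and3P; rewrite (edge_sym I).
have /forall_inP/(_ y yC) xy := Cc x (subsetP SC x xS).
by move: (closed_connect clS xy : (x \in S) = (y \in S)); rewrite xS (negPf yS).
Qed.

Lemma connected0 : connected I set0.
Proof. by apply/forall_inP => x; rewrite inE. Qed.

Lemma connected1 v : connected I [set v].
Proof.
apply/forall_inP => x /set1P ->; apply/forall_inP => y /set1P ->.
exact: connect0.
Qed.

Lemma connectedU1 S v : connected I S ->
  (S == set0) || [exists u in S, edge I u v] -> connected I (v |: S).
Proof.
move=> Sc /orP[/eqP->|/exists_inP[u uS uv]].
  by rewrite setU0 connected1.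
have sub x y : x \in S -> y \in S -> connect (induced I (v |: S)) x y.
  move=> xS yS; have /forall_inP/(_ x xS)/forall_inP/(_ y yS) := Sc.
  apply: connect_sub => a b /and3P[aS bS ab].
  by apply: connect1; apply/and3P; rewrite !inE aS bS ab !orbT.
have tov x : x \in S -> connect (induced I (v |: S)) x v.
  move=> xS; apply: connect_trans (sub _ _ xS uS) _; apply: connect1.
  by apply/and3P; rewrite !inE uS uv eqxx orbT.
apply/forall_inP => x /setU1P[->|xS]; apply/forall_inP => y /setU1P[->|yS].
- exact: connect0.
- by rewrite connect_induced_sym tov.
- exact: tov.
- exact: sub.
Qed.

(** Induction on [k]: a set still smaller than [C] is left by an edge inside [C], whose far end is
    added. *)
Lemma connected_grow B C k : connected I B -> connected I C -> B != set0 ->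
    B \subset C -> #|B| <= k <= #|C| ->
  exists S, [/\ connected I S, B \subset S, S \subset C & #|S| = k].
Proof.
move=> Bc Cc B0 BC /andP[Bk kC]; elim: k Bk kC => [|k IHk].
  by rewrite leqn0 cards_eq0 (negPf B0).
rewrite leq_eqVlt => /predU1P[<- _|]; first by exists B.
rewrite ltnS => Bk kC; have [S [Sc BS SC Sk]] := IHk Bk (ltnW kC).
have S0 : S != set0.
  by apply: contraNneq B0 => S0; rewrite -subset0 -S0.
have [|u [v [uS /setDP[vC vS] uv]]] := connected_cross Cc S0 _.
  by rewrite properEcard SC Sk.
exists (v |: S); split.
- by apply: connectedU1 => //; apply/orP; right; apply/exists_inP; exists u.
- by apply: subset_trans BS (subsetUr _ _).
- by rewrite subUset sub1set vC.
- by rewrite cardsU1 vS Sk.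
Qed.

(** Singletons are connected. *)
Lemma kappa_ge : n <= kappa I.
Proof.
rewrite -{1}(card_ord n) -(card_imset _ (@set1_inj 'I_n)); apply: subset_leq_card.
apply/subsetP => _ /imsetP[v _ ->]; rewrite inE connected1 andbT.
by apply/set0Pn; exists v; rewrite inE.
Qed.

Definition feasibleb (T : assignment n p) : bool :=
  [forall a, connected I (players_of T a)].

Lemma feasibleP T : reflect (feasible I T) (feasibleb T).
Proof.
apply: (iffP forallP) => [Tc i|Tf a].
  by rewrite /coalition; case: (T i) => [a|]; [apply: Tc|apply: connected1].
have [->|[i]] := set_0Vmem (players_of T a); first exact: connected0.
by rewrite inE => /eqP Ti; have := Tf i; rewrite /coalition Ti.
Qed.

Lemma card_feasible : 0 < n ->
  #|[set T | feasibleb T]| <= 4 * kappa I ^ p * (n + p) ^ 3.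
Proof.
move=> n0; apply: leq_trans (count_le p n0 kappa_ge); rewrite leq_min.
apply/andP; split; last first.
  by apply: leq_trans (max_card _) _; rewrite card_ffun card_option !card_ord.
pose K := [set S | connected I S].
have cK : #|K| = (kappa I).+1.
  rewrite (cardsD1 set0) inE connected0; congr _.+1; apply: eq_card => S.
  by rewrite !inE.
pose f (T : assignment n p) := [ffun a => players_of T a].
(* The groups determine the assignment: a player in none of them is void. *)
have f_inj : injective f.
  move=> T1 T2 /ffunP fT; apply/ffunP => i; have ft a := fT a.
  have mem a : (T1 i == Some a) = (T2 i == Some a).
    by have := ft a; rewrite !ffunE => /setP/(_ i); rewrite !inE.
  case E1: (T1 i) => [a|].
    by have := mem a; rewrite E1 eqxx => /esym/eqP.
  by case E2: (T2 i) => [a|] //; have := mem a; rewrite E1 E2 eqxx.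
have -> : (kappa I).+1 ^ p = #|@ffun_on_mem 'I_p _ (mem K)|.
  by rewrite card_ffun_on cK card_ord.
rewrite -(card_imset _ f_inj); apply: subset_leq_card; apply/subsetP => _ /imsetP[T + ->].
rewrite inE => /forallP Tc; apply/ffun_onP => a.
by rewrite ffunE inE.
Qed.

End Connected.

(** * The decision tree of feasible assignments *)

Lemma foldl_flatten (T R : Type) (f : R -> T -> R) z (ss : seq (seq T)) :
  foldl f z (flatten ss) = foldl (foldl f) z ss.
Proof. by elim: ss z => //= s ss IH z; rewrite foldl_cat. Qed.

Lemma foldl_map (T U R : Type) (f : R -> T -> R) (g : U -> T) z s :
  foldl f z (map g s) = foldl (fun z x => f z (g x)) z s.
Proof. by elim: s z => /=. Qed.

Lemma iter_inv (X : Type) (f : X -> X) (Inv : X -> Prop) k x :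
  (forall x, Inv x -> Inv (f x)) -> Inv x -> Inv (iter k f x).
Proof. by move=> If Ix; elim: k => //= k; apply: If. Qed.

(** As long as [good] fails, every application raises the measure; if it still failed after [m]
    applications, one more would push the measure above its bound [m]. Used with [m = n] both for
    the sweeps and for the closure that computes components. *)
Lemma iter_growth (X : Type) (f : X -> X) (Inv : X -> Prop) (good : pred X)
    (mu : X -> nat) (m : nat) x :
    (forall x, Inv x -> Inv (f x)) ->
    (forall x, Inv x -> mu x <= m) ->
    (forall x, Inv x -> good x -> good (f x)) ->
    (forall x, Inv x -> ~~ good x -> mu x < mu (f x)) ->
  Inv x -> good (iter m f x).
Proof.
move=> If Im gf uf Ix.
have II k : Inv (iter k f x) by apply: iter_inv.
suff H k : good (iter k f x) \/ k <= mu (iter k f x).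
  have [//|mm] := H m; case: (boolP (good (iter m f x))) => // ng.
  have := uf _ (II m) ng; have := Im _ (II m.+1) => /=; lia.
elim: k => [|k [g|km]] /=; first by right.
  by left; apply: gf.
case: (boolP (good (iter k f x))) => [g|ng]; first by left; apply: gf.
by right; apply: leq_ltn_trans km _; apply: uf.
Qed.

Lemma foldl_iter_enum N (X : Type) (f : X -> X) x :
  foldl (fun z (_ : 'I_N) => f z) x (enum 'I_N) = iter N f x.
Proof.
rewrite -[in RHS](size_enum_ord N).
by elim: (enum 'I_N) x => //= i l IHl x; rewrite IHl -iterSr.
Qed.

Notation state n p :=
  (assignment n p * {set 'I_p * 'I_n} * option (assignment n p))%type.

Section Tree.
Variables (n p : nat) (I : gGASP n p).

Implicit Types (st : state n p) (T L : assignment n p) (R : {set 'I_p * 'I_n})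
  (sl : 'I_p * 'I_n) (sls : seq ('I_p * 'I_n)).

Definition assign L sl : assignment n p :=
  [ffun u => if u == sl.2 then Some sl.1 else L u].

(* [L] collects the pairs accepted so far, [R] those rejected. *)
Definition open L R sl : bool :=
  [&& L sl.2 == None, sl \notin R &
   (players_of L sl.1 == set0) ||
   [exists u in players_of L sl.1, edge I u sl.2]].

(** Left branches reject, right branches accept, and a pair that is not open gives no branching.
    Since rejecting leaves the labels alone, the leftmost leaf below a node is its own [L]. *)
Fixpoint leaves L R sls : seq (assignment n p) :=
  if sls is sl :: sls' then
    if open L R sl then
      leaves L (sl |: R) sls' ++ leaves (assign L sl) R sls'
    else leaves L R sls'
  else [:: L].

(* Follows the branch leading to [T], remembering the leftmost leaf of the last
   branch passed on its right. *)
Definition follow T st sl : state n p :=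
  let: (L, R, N) := st in
  if open L R sl then
    if T sl.2 == Some sl.1 then (assign L sl, R, N)
    else (L, sl |: R, Some (assign L sl))
  else st.

Definition sweep (a : 'I_p) := [seq (a, v) | v <- enum 'I_n].
(** A single sweep can pass a player before a neighbour of that player joins. With [n] sweeps every
    connected group is reached, as each sweep that does not find it complete enlarges it. *)
Definition block (a : 'I_p) := flatten [seq sweep a | _ <- enum 'I_n].
Definition slots := flatten [seq block a | a <- enum 'I_p].

Definition all_void : assignment n p := [ffun=> None].

Lemma players_assign L sl b : L sl.2 = None ->
  players_of (assign L sl) b =
  if b == sl.1 then sl.2 |: players_of L b else players_of L b.
Proof.
move=> L0; apply/setP => u; rewrite inE ffunE.
case: ifP => [/eqP ->|us]; case: ifP => [/eqP ->|bs].
- by rewrite !inE !eqxx.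
- by rewrite inE L0; apply/eqP => [[E]]; rewrite E eqxx in bs.
- by rewrite !inE us.
- by rewrite inE.
Qed.

Lemma leaves_gt0 L R sls : 0 < size (leaves L R sls).
Proof.
elim: sls L R => //= sl sls IH L R; case: ifP => // _.
by rewrite size_cat addn_gt0 IH.
Qed.

Lemma leaves_head d L R sls : nth d (leaves L R sls) 0 = L.
Proof.
elim: sls L R => [|sl sls IH] L R //=; case: ifP => // _.
by rewrite nth_cat IH leaves_gt0.
Qed.

Lemma leaves_label L R sls T v b :
  T \in leaves L R sls -> L v = Some b -> T v = Some b.
Proof.
elim: sls L R => [|sl sls IH] L R /=; first by rewrite inE => /eqP ->.
case: ifP => [/and3P[/eqP L0 _ _]|_]; last exact: IH.
rewrite mem_cat => /orP[]; first exact: IH.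
move=> /IH H Lv; apply: H; rewrite ffunE; case: eqP => // E.
by rewrite E L0 in Lv.
Qed.

(** A rejected pair is never open again, so it cannot be accepted further down. *)
Lemma leaves_rejected L R sls T sl :
    T \in leaves L R sls -> sl \in R -> L sl.2 != Some sl.1 ->
  T sl.2 != Some sl.1.
Proof.
elim: sls L R => [|sl' sls IH] L R /=; first by rewrite inE => /eqP ->.
case: ifP => [/and3P[/eqP L0 slR _]|_]; last exact: IH.
rewrite mem_cat => /orP[/IH H sR|/IH H sR Ls].
  by apply: H; rewrite inE sR orbT.
apply: H => //; rewrite ffunE; case: (sl.2 =P sl'.2) => // E; apply/negP => /eqP[E1].
case/negP: slR; suff -> : sl' = sl by [].
by apply/eqP; rewrite -pair_eqE /pair_eq E E1 !eqxx.
Qed.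

(** The two subtrees of a question are told apart by the label of the player asked. This gives
    uniqueness of the leaves, and lets [follow] pick the branch by looking at [T] alone. *)
Lemma leaves_split L R sls sl : L sl.2 = None ->
  (forall T, T \in leaves L (sl |: R) sls -> T sl.2 != Some sl.1) /\
  (forall T, T \in leaves (assign L sl) R sls -> T sl.2 = Some sl.1).
Proof.
move=> L0; split=> T Tl.
  by apply: leaves_rejected Tl _ _; rewrite ?setU11 ?L0.
by apply: leaves_label Tl _; rewrite ffunE eqxx.
Qed.

Lemma leaves_uniq L R sls : uniq (leaves L R sls).
Proof.
elim: sls L R => [|sl sls IH] L R //=; case: ifP => [|_]; last exact: IH.
move=> /and3P[/eqP L0 _ _]; have [H0 H1] := leaves_split R sls L0.
rewrite cat_uniq !IH andbT; apply/hasPn => T /H1 T1.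
by apply/negP => /H0; rewrite T1 eqxx.
Qed.

(** An accepted player founds the group or is adjacent to it, so all groups stay connected along a
    branch. *)
Lemma leaves_feasible L R sls T :
  feasibleb I L -> T \in leaves L R sls -> feasibleb I T.
Proof.
elim: sls L R => [|sl sls IH] L R /=; first by rewrite inE => ? /eqP ->.
case: ifP => [/and3P[/eqP L0 _ adj]|_] Lf; last exact: IH Lf.
rewrite mem_cat => /orP[]; first exact: IH.
apply: IH; apply/forallP => b; rewrite players_assign //.
have /forallP/(_ b) Lb := Lf; case: eqP => // Eb.
by apply: connectedU1 => //; rewrite Eb.
Qed.

(** The remembered leaf is the successor of [T] in the enumeration; [N], inherited from above, is
    the answer when [T] is the last leaf of this subtree. *)
Lemma follow_next T L R N sls : T \in leaves L R sls ->
  (foldl (follow T) (L, R, N) sls).2 =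
  nth N (map Some (leaves L R sls)) (index T (leaves L R sls)).+1.
Proof.
elim: sls L R N => [|sl sls IH] L R N /=.
  by rewrite inE => /eqP ->; rewrite eqxx.
case: ifP => [|_]; last exact: IH.
move=> /and3P[/eqP L0 _ _]; have [H0 H1] := leaves_split R sls L0.
rewrite mem_cat index_cat map_cat nth_cat size_map.
set l0 := leaves L _ sls in H0 *; set l1 := leaves _ R sls in H1 *.
have [T0 _|T0 /= T1] := boolP (T \in l0).
  rewrite (negPf (H0 _ T0)) IH // -/l0.
  (* If [T] is last in the left subtree, its successor is the head of the right one, namely
     [assign L sl], which is what [follow] stored. Otherwise the default value is irrelevant. *)
  have := T0; rewrite -index_mem leq_eqVlt => /predU1P[E|E].
    rewrite E ltnn subnn nth_default ?size_map ?E //.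
    rewrite (nth_map L) ?leaves_head //; exact: leaves_gt0.
  by rewrite E; apply: set_nth_default; rewrite size_map.
rewrite H1 // eqxx IH // -/l1 ltnNge -addnS leq_addr /=.
by rewrite addKn.
Qed.

Lemma follow_mem T L R N sls :
  (foldl (follow T) (L, R, N) sls).1.1 \in leaves L R sls.
Proof.
elim: sls L R N => [|sl sls IH] L R N /=; first by rewrite inE.
case: ifP => // _; case: ifP => _; rewrite mem_cat IH ?orbT //.
Qed.

(** Serves to show that no pair of an activity has been rejected before the block of that activity
    starts. *)
Lemma foldl_rejected T st sls sl :
  sl \in (foldl (follow T) st sls).1.2 -> sl \in st.1.2 \/ sl \in sls.
Proof.
elim: sls st => [|sl' sls IH] st /=; first by left.
case/IH => [|H]; last by right; rewrite inE H orbT.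
move: st => [[L R] N] /=; case: ifP => _; last by left.
case: ifP => _ /=; first by left.
by move=> /setU1P[->|]; [right; rewrite mem_head|left].
Qed.

Lemma mem_block a sl : sl \in block a -> sl.1 = a.
Proof. by move=> /flatten_mapP[_ _ /mapP[v _ ->]]. Qed.

(** Invariant of the descent towards [T]: no answer given so far contradicts [T]. *)
Definition consistent T st : Prop :=
  (forall v b, st.1.1 v = Some b -> T v = Some b) /\
  (forall sl, sl \in st.1.2 -> T sl.2 != Some sl.1).

Lemma follow_consistent T st sl :
  consistent T st -> consistent T (follow T st sl).
Proof.
move: st => [[L R] N] [/= HL HR]; rewrite /follow.
case: ifP => // _; case: ifP => [/eqP Ts|/negbT Ts]; split=> //= v.
  by move=> b; rewrite ffunE; case: eqP => [-> [<-]|_]; last exact: HL.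
by move=> /setU1P[->|/HR].
Qed.

Lemma foldl_consistent T st sls :
  consistent T st -> consistent T (foldl (follow T) st sls).
Proof.
by elim: sls st => //= sl sls IH st H; apply/IH/follow_consistent.
Qed.

Lemma follow_label T st sl v b :
  st.1.1 v = Some b -> (follow T st sl).1.1 v = Some b.
Proof.
move: st => [[L R] N] /= Lv; rewrite /follow; case: ifP => // /andP[/eqP L0 _].
case: ifP => //= _; rewrite ffunE; case: eqP => // E.
by rewrite E L0 in Lv.
Qed.

Lemma foldl_label T st sls v b :
  st.1.1 v = Some b -> (foldl (follow T) st sls).1.1 v = Some b.
Proof. by elim: sls st => //= sl sls IH st H; apply/IH/follow_label. Qed.

(** Until somebody joins the group of [a], the labels do not change and [v] remains eligible. If
    nobody joins earlier, the pair [(a, v)] is open when it is reached, and [T] accepts it. *)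
Lemma follow_frontier T st sls a v :
    consistent T st -> (a, v) \in sls -> all (fun sl => sl.1 == a) sls ->
    T v = Some a -> v \notin players_of st.1.1 a ->
    (players_of st.1.1 a == set0) ||
      [exists u in players_of st.1.1 a, edge I u v] ->
  #|players_of st.1.1 a| < #|players_of (foldl (follow T) st sls).1.1 a|.
Proof.
move=> ct + + Tv; elim: sls st ct => //= sl sls IH st ct.
move=> vs /andP[/eqP sla alla] vN adj.
have sub : players_of (follow T st sl).1.1 a
    \subset players_of (foldl (follow T) (follow T st sl) sls).1.1 a.
  by apply/subsetP => u; rewrite !inE => /eqP H; rewrite (foldl_label _ _ H).
have grown w : w \notin players_of st.1.1 a ->
    w \in players_of (follow T st sl).1.1 a ->
    #|players_of st.1.1 a|
      < #|players_of (foldl (follow T) (follow T st sl) sls).1.1 a|.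
  move=> wN wY; apply: leq_trans (subset_leq_card sub); apply: proper_card.
  rewrite properE; apply/andP; split.
    apply/subsetP => u; rewrite !inE => /eqP H.
    by rewrite (follow_label _ _ H).
  by apply/subsetPn; exists w.
have ct' := follow_consistent sl ct.
move: st ct vN adj sub grown ct' => [[L R] N] /= [cL cR] vN adj sub grown.
rewrite /follow in sub grown *; case E: (open L R sl) in sub grown *; last first.
  move=> ct'; apply: (IH (L, R, N)) => //.
  move: vs; rewrite inE => /predU1P[Es|//]; case/negP: (negbT E).
  rewrite /open -Es /= adj andbT; apply/andP; split; last first.
    by apply/negP => /cR; rewrite /= Tv eqxx.
  case Lv: (L v) => [b|] //; have := cL _ _ Lv; rewrite Tv => [[Eb]].
  by move: vN; rewrite inE Lv Eb eqxx.
case Ts: (T sl.2 == Some sl.1) in sub grown *.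
  move=> _; apply: (grown sl.2) => /=.
    move: E => /andP[/eqP L0 _].
    by rewrite inE L0.
  by rewrite inE ffunE eqxx sla.
move=> ct'; apply: (IH (L, sl |: R, _)) => //.
move: vs; rewrite inE => /predU1P[Es|//].
by rewrite -Es /= Tv eqxx in Ts.
Qed.

Lemma foldl_block T st a :
  foldl (follow T) st (block a) =
  iter n (fun st => foldl (follow T) st (sweep a)) st.
Proof. by rewrite foldl_flatten foldl_map foldl_iter_enum. Qed.

(** By [iter_growth] with the size of the group as measure: while the group is a proper part of its
    final value in [T], some player is on the frontier and the next sweep enlarges it. *)
Lemma follow_block T st a : feasibleb I T -> consistent T st ->
  players_of (foldl (follow T) st (block a)).1.1 a = players_of T a.
Proof.
move=> /forallP/(_ a) Tc ct; rewrite foldl_block; apply/eqP.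
set f := fun st => _.
pose good st := players_of st.1.1 a == players_of T a.
suff: good (iter n f st) by [].
have sub st' : consistent T st' -> players_of st'.1.1 a \subset players_of T a.
  by move=> [cL _]; apply/subsetP => v; rewrite !inE => /eqP/cL ->.
have cf st' : consistent T st' -> consistent T (f st').
  exact: foldl_consistent.
apply: (@iter_growth _ f (consistent T) _ (fun st => #|players_of st.1.1 a|)) => //.
- by move=> st' _; rewrite -[X in _ <= X]card_ord max_card.
- move=> st' ct' /eqP Eg; rewrite /good eqEsubset (sub _ (cf _ ct')) /=.
  rewrite -Eg; apply/subsetP => v; rewrite !inE => /eqP H.
  by rewrite (foldl_label _ _ H).
- move=> st' ct' ng.
  have prop : players_of st'.1.1 a \proper players_of T a.
    by rewrite properEneq ng sub.
  have frontier v : T v = Some a -> v \notin players_of st'.1.1 a ->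
      (players_of st'.1.1 a == set0) ||
      [exists u in players_of st'.1.1 a, edge I u v] ->
      #|players_of st'.1.1 a| < #|players_of (f st').1.1 a|.
    apply: follow_frontier => //; last by rewrite all_map; apply/allP => v' /=.
    by apply: map_f; rewrite mem_enum.
  (* Any member of an empty group may found it; a nonempty one is left by an edge inside the
     connected final group. *)
  have [E0|N0] := eqVneq (players_of st'.1.1 a) set0.
    have /properP[_ [v]] := prop; rewrite inE => /eqP Tv vN.
    by apply: (frontier v); rewrite // E0 eqxx.
  have [u [v [uS /setDP[+ vN] uv]]] := connected_cross Tc N0 prop.
  rewrite inE => /eqP Tv; apply: (frontier v) => //.
  by apply/orP; right; apply/exists_inP; exists u.
Qed.

(** The leaf reached by following [T] is [T] itself: each block completes the group of its activity,
    later blocks erase no label, and consistency keeps the void players void. *)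
Lemma mem_leaves T : feasibleb I T -> T \in leaves all_void set0 slots.
Proof.
move=> Tf; have := follow_mem T all_void set0 None slots.
set st := foldl _ _ _; suff -> : st.1.1 = T by [].
have c0 : consistent T (all_void, set0, None).
  by split=> [v b|sl]; rewrite /= ?ffunE // inE.
have cst : consistent T st by apply: foldl_consistent.
apply/ffunP => v; case Tv: (T v) => [a|]; last first.
  by case E: (st.1.1 v) => [b|] //; have := cst.1 _ _ E; rewrite Tv.
rewrite /st /slots foldl_flatten foldl_map.
have [s1 [s2 ->]] : exists s1 s2, enum 'I_p = s1 ++ a :: s2.
  have : a \in enum 'I_p by rewrite mem_enum.
  by case/splitPr => s1 s2; exists s1, s2.
rewrite foldl_cat /=; set st1 := foldl _ _ s1.
have c1 : consistent T st1.
  rewrite /st1; elim: (s1) (_, _, _) c0 => //= b s IH st0 c.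
  by apply/IH/foldl_consistent.
have : v \in players_of (foldl (follow T) st1 (block a)).1.1 a.
  by rewrite follow_block // inE Tv.
rewrite inE => /eqP; move: (foldl _ st1 _) => st2; elim: s2 st2 => //= b s2 IH st2.
by move=> /(foldl_label T (block b)); apply: IH.
Qed.

Lemma size_leaves : size (leaves all_void set0 slots) <= #|[set T | feasibleb I T]|.
Proof.
rewrite -(card_uniqP (leaves_uniq all_void set0 slots)).
apply: subset_leq_card; apply/subsetP => T Tl; rewrite inE.
apply: leaves_feasible Tl; apply/forallP => a.
suff -> : players_of all_void a = set0 by apply: connected0.
by apply/setP => v; rewrite !inE ffunE.
Qed.

(** * Deciding core stability *)

Implicit Types (P D S : {set 'I_n}) (u v r : 'I_n).

Definition absorb P D v :=
  if (v \in P) && [exists u in D, edge I u v] then v |: D else D.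

(** The component of [r] in the subgraph induced by [P], empty if [r] is not in [P]; [n] passes of
    absorption suffice to complete it. *)
Definition reach P r : {set 'I_n} :=
  foldl (fun D (_ : 'I_n) => foldl (absorb P) D (enum 'I_n))
    (P :&: [set r]) (enum 'I_n).

Lemma absorb_sub P D v : D \subset absorb P D v.
Proof. by rewrite /absorb; case: ifP => // _; apply: subsetUr. Qed.

Lemma foldl_absorb_sub P D s : D \subset foldl (absorb P) D s.
Proof.
elim: s D => //= v s IH D.
exact: subset_trans (absorb_sub _ _ _) (IH _).
Qed.

Definition absorbed P D :=
  [forall v in P, forall u in D, edge I u v ==> (v \in D)].

Lemma absorbedP P D : reflect
  (forall u v, v \in P -> u \in D -> edge I u v -> v \in D) (absorbed P D).
Proof.
apply: (iffP forall_inP) => [H u v vP uD uv|H v vP].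
  by have /forall_inP/(_ u uD)/implyP/(_ uv) := H v vP.
by apply/forall_inP => u uD; apply/implyP; apply: H.
Qed.

Lemma reachP P r :
  [/\ connected I (reach P r), reach P r \subset P,
      (r \in P -> r \in reach P r) & absorbed P (reach P r)].
Proof.
rewrite /reach foldl_iter_enum; set D0 := P :&: [set r]; set f := fun D => _.
have inv_absorb D v : connected I D /\ D \subset P ->
    connected I (absorb P D v) /\ absorb P D v \subset P.
  rewrite /absorb => -[Dc DP]; case: ifP => // /andP[vP adj]; split.
    by apply: connectedU1 => //; rewrite adj orbT.
  by rewrite subUset sub1set vP.
have inv D : connected I D /\ D \subset P -> connected I (f D) /\ f D \subset P.
  rewrite /f; elim: (enum _) D => //= v s IH D H; apply: IH.
  exact: inv_absorb.
have inv0 : connected I D0 /\ D0 \subset P.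
  rewrite /D0 subsetIl; split=> //; have [rP|rP] := boolP (r \in P).
    by rewrite (setIidPr _) ?sub1set //; apply: connected1.
  have -> : P :&: [set r] = set0 by apply/setP => x; rewrite !inE;
    case: eqP => [->|]; rewrite ?(negPf rP) ?andbF.
  exact: connected0.
have fsub D : D \subset f D by apply: foldl_absorb_sub.
have [c s] : connected I (iter n f D0) /\ iter n f D0 \subset P.
  exact: (iter_inv n inv).
split=> //.
  move=> rP; have : r \in D0 by rewrite !inE rP eqxx.
  apply/subsetP; apply: (iter_inv (Inv := fun D => D0 \subset D)) => // D H.
  exact: subset_trans H (fsub _).
apply: (@iter_growth _ f (fun D => connected I D /\ D \subset P) _
  (fun D : {set 'I_n} => #|D|)) => //.
- by move=> D _; rewrite -[X in _ <= X]card_ord max_card.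
(* A set closed under edges into [P] is a fixed point of the pass. *)
- move=> D _ /absorbedP H; suff -> : f D = D by apply/absorbedP.
  rewrite /f; elim: (enum _) => //= v s' IH.
  suff -> : absorb P D v = D by [].
  rewrite /absorb; case: ifP => // /andP[vP /exists_inP[u uD uv]].
  by apply/setUidPr; rewrite sub1set (H u).
- move=> D _; rewrite negb_forall_in => /exists_inP[v vP].
  rewrite negb_forall_in => /exists_inP[u uD]; rewrite negb_imply => /andP[uv vD].
  apply: proper_card; rewrite properE fsub; apply/subsetPn; exists v => //.
  (* Absorption only adds players, so [u] is still present when the pass comes to [v]. *)
  have : v \in enum 'I_n by rewrite mem_enum.
  rewrite /f; elim: (enum _) D uD {vD} => //= w s' IH D uD.
  rewrite inE => /predU1P[<-|vs]; last first.
    by apply: IH => //; apply: subsetP uD; apply: absorb_sub.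
  apply: (subsetP (foldl_absorb_sub _ _ _)); rewrite /absorb vP.
  have -> : [exists u0 in D, edge I u0 v] by apply/exists_inP; exists u.
  by rewrite setU11.
Qed.

(** Otherwise an edge inside [S] would leave [S :&: reach P r], although [reach P r] is closed under
    edges into [P]. *)
Lemma reach_max P S r : r \in S -> S \subset P ->
  connected I S -> S \subset reach P r.
Proof.
move=> rS SP Sc; have [_ _ rD /absorbedP aD] := reachP P r.
apply/setIidPl/eqP; apply: contraT => neq.
have [||u [v [/setIP[uS uD] /setDP[vS]]]] := @connected_cross _ _ I S
  (S :&: reach P r) Sc.
- by apply/set0Pn; exists r; rewrite inE rS rD ?(subsetP SP).
- by rewrite properEneq neq subsetIl.
by rewrite inE vS /= => vD /(aD _ _ (subsetP SP _ vS) uD); rewrite (negPf vD).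
Qed.

Definition eager T a k : {set 'I_n} :=
  [set v | sprefers I v (Some a, k) (outcome T v)].

Definition blocked_from T a k r : bool :=
  let D := reach (eager T a k) r in
  [&& players_of T a \subset D, k <= #|D| & #|players_of T a| <= k].

Definition irrational T : bool :=
  [exists v, ~~ pref I v (outcome T v) (None, 1)].

Definition stable T : bool :=
  ~~ (irrational T ||
      [exists a : 'I_p, exists k : 'I_n, exists r, blocked_from T a k.+1 r]).

Lemma stableP T : feasible I T -> reflect (core_stable I T) (stable T).
Proof.
move=> Tf; have /feasibleP/forallP Tc := Tf.
rewrite /stable negb_or; apply: (iffP andP) => [[ir nb]|[_ ir nb]].
  split=> //; first by move=> v; apply: contraNT ir => ?; apply/existsP; exists v.
  move=> [S [a [/set0Pn[r rS] Sc [TS Sp]]]]; case/negP: nb.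
  have S0 : 0 < #|S| by apply/card_gt0P; exists r.
  have Sn : #|S|.-1 < n by rewrite prednK // -[X in _ <= X]card_ord max_card.
  (* Sizes are tested as [k.+1] with [k : 'I_n], hence the predecessor of [#|S|]; any member of [S]
     serves as root. *)
  apply/existsP; exists a; apply/existsP; exists (Ordinal Sn).
  apply/existsP; exists r; rewrite /blocked_from /= prednK //.
  have SP : S \subset eager T a #|S|.
    by apply/subsetP => v vS; rewrite inE Sp.
  have SD := reach_max rS SP Sc.
  by rewrite (subset_trans TS SD) !subset_leq_card.
split.
  by apply/negP => /existsP[v]; rewrite ir.
apply/negP => /existsP[a /existsP[k /existsP[r /and3P[TD kD Tk]]]].
have [Dc DP _ _] := reachP (eager T a k.+1) r.
set D := reach _ _ in TD kD Dc DP.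
have [x xD] : exists x, x \in D by apply/card_gt0P; apply: leq_trans kD.
pose B := if players_of T a == set0 then [set x] else players_of T a.
have [Bc B0 BD Bk] :
    [/\ connected I B, B != set0, B \subset D & #|B| <= k.+1].
  rewrite /B; case: eqP => [_|/eqP T0]; split=> //; first exact: connected1.
  - by apply/set0Pn; exists x; rewrite inE.
  - by rewrite sub1set.
  - by rewrite cards1.
have [|S [Sc BS SD Sk]] := connected_grow (k := k.+1) Bc Dc B0 BD.
  by rewrite Bk.
apply: nb; exists S, a; split=> //; first by rewrite -card_gt0 Sk.
split.
  by move: BS; rewrite /B; case: eqP => // -> _; apply: sub0set.
move=> v vS; have := subsetP DP v (subsetP SD v vS).
by rewrite inE Sk.
Qed.

End Tree.

(** * The program *)

Notation r_n := 0 (only parsing).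
Notation r_p := 1 (only parsing).
Notation r_found := 2 (only parsing).
Notation r_go := 3 (only parsing).
Notation r_more := 4 (only parsing).
Notation r_a := 5 (only parsing).
Notation r_k := 6 (only parsing).
Notation r_v := 7 (only parsing).
Notation r_u := 8 (only parsing).
Notation r_nonempty := 9 (only parsing).
Notation r_adj := 10 (only parsing).
Notation r_bad := 11 (only parsing).
Notation r_root := 12 (only parsing).
Notation r_i := 13 (only parsing).
Notation r_card := 14 (only parsing).
Notation r_size := 15 (only parsing).
Notation r_out := 16 (only parsing).

Notation a_cur := 0 (only parsing).
Notation a_lab := 1 (only parsing).
Notation a_rej := 2 (only parsing).
Notation a_next := 3 (only parsing).
Notation a_size := 4 (only parsing).
Notation a_eager := 5 (only parsing).
Notation a_clos := 6 (only parsing).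

Notation act := (ESucc (EReg r_a)) (only parsing).
Notation cell b x := (EGet b (EReg x)) (only parsing).

(** One step of [follow]. Every refusal overwrites [a_next] with the current labels plus the refused
    pair, so the last refusal prevails; [r_more] records whether there was one. *)
Definition visit : cmd :=
  CSeq (CAny r_u r_n r_nonempty (EEq (cell a_lab r_u) act))
  (CSeq (CAny r_u r_n r_adj
           (EAnd (EEq (cell a_lab r_u) act) (EEdge (EReg r_u) (EReg r_v))))
  (CIf (EAnd (ENot (cell a_lab r_v))
             (EAnd (ENot (cell a_rej r_v))
                   (ENot (EAnd (EReg r_nonempty) (ENot (EReg r_adj))))))
     (CIf (EEq (cell a_cur r_v) act)
        (CPut a_lab (EReg r_v) act)
        (CSeq (CPut a_rej (EReg r_v) (EConst 1))
        (CSeq (CSet r_more (EConst 1))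
        (CSeq (CMap r_u r_n a_next (cell a_lab r_u))
              (CPut a_next (EReg r_v) act)))))
     CSkip)).

Definition replay : cmd :=
  CSeq (CMap r_v r_n a_lab (EConst 0))
  (CSeq (CSet r_more (EConst 0))
  (CFor r_a r_p
     (CSeq (CMap r_v r_n a_rej (EConst 0))
           (CFor r_i r_n (CFor r_v r_n visit))))).

Definition sizes : cmd :=
  CFor r_v r_n
    (CIf (ENot (cell a_cur r_v))
       (CPut a_size (EReg r_v) (EConst 1))
       (CSeq (CCount r_u r_n r_card (EEq (cell a_cur r_u) (cell a_cur r_v)))
             (CPut a_size (EReg r_v) (EReg r_card)))).

Definition closing : cmd :=
  CSeq (CMap r_v r_n a_clos
          (EAnd (cell a_eager r_v) (EEq (EReg r_v) (EReg r_root))))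
  (CFor r_i r_n (CFor r_v r_n
     (CSeq (CAny r_u r_n r_adj
              (EAnd (cell a_clos r_u) (EEdge (EReg r_u) (EReg r_v))))
           (CIf (EAnd (cell a_eager r_v) (EReg r_adj))
              (CPut a_clos (EReg r_v) (EConst 1))
              CSkip)))).

(* Register [r_k] holds the size of the deviating coalition minus one. *)
Definition try_root : cmd :=
  CSeq closing
  (CSeq (CCount r_v r_n r_card (cell a_clos r_v))
  (CSeq (CCount r_v r_n r_size (EEq (cell a_cur r_v) act))
  (CSeq (CAny r_v r_n r_out
           (EAnd (EEq (cell a_cur r_v) act) (ENot (cell a_clos r_v))))
  (CIf (EAnd (ENot (EReg r_out))
             (EAnd (ELt (EReg r_k) (EReg r_card))
                   (ELt (EReg r_size) (ESucc (ESucc (EReg r_k))))))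
     (CSet r_bad (EConst 1))
     CSkip)))).

Definition find_eager : cmd :=
  CMap r_v r_n a_eager
    (EAnd (EPref (EReg r_v) act (ESucc (EReg r_k))
             (cell a_cur r_v) (cell a_size r_v))
          (ENot (EPref (EReg r_v) (cell a_cur r_v) (cell a_size r_v)
                   act (ESucc (EReg r_k))))).

Definition test : cmd :=
  CSeq sizes
  (CSeq (CAny r_v r_n r_bad
           (ENot (EPref (EReg r_v) (cell a_cur r_v) (cell a_size r_v)
                    (EConst 0) (EConst 1))))
  (CFor r_a r_p (CFor r_k r_n
     (CSeq find_eager (CFor r_root r_n try_root))))).

(** If the leaf fails and has no successor, the loop stops with [r_found] still 0; if it passes,
    [a_cur] is left as it is and holds the answer. *)
Definition round : cmd :=
  CSeq replay
  (CSeq test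
  (CIf (EReg r_bad)
     (CIf (EReg r_more)
        (CMap r_v r_n a_cur (cell a_next r_v))
        (CSet r_go (EConst 0)))
     (CSeq (CSet r_found (EConst 1)) (CSet r_go (EConst 0))))).

(** The arrays are initially zero, so [a_cur] starts as the all-void assignment, which is the first
    leaf. The verdict goes into register 0 only at the end, because that register holds [n]. *)
Definition solver : cmd :=
  CSeq (CSet r_go (EConst 1))
  (CSeq (CWhile (EReg r_go) round)
        (CSet 0 (EReg r_found))).

(** * Correctness of the program *)

Section Correctness.
Variables (n p : nat) (I : gGASP n p).
Implicit Types (s : store) (T L : assignment n p) (D P : {set 'I_n})
  (a : 'I_p) (v u r : 'I_n).

Lemma n_le : n <= n + p. Proof. exact: leq_addr. Qed.
Lemma p_le : p <= n + p. Proof. exact: leq_addl. Qed.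
Local Hint Resolve n_le p_le : core.

Lemma code_inj : injective (@code p).
Proof. by move=> [x|] [y|] //= [/val_inj ->]. Qed.

Lemma code_eq (x y : activity p) : (code x == code y) = (x == y).
Proof. exact: (inj_eq code_inj). Qed.

Lemma code_eqS (x : activity p) a : (code x == a.+1) = (x == Some a).
Proof. exact: (code_eq x (Some a)). Qed.

Lemma code_eq0 (x : activity p) : (code x == 0) = (x == None).
Proof. exact: (code_eq x None). Qed.

Lemma edge_queryE u v : edge_query I u v = edge I u v.
Proof.
apply/existsP/idP => [[x /existsP[y /and3P[/eqP/val_inj -> /eqP/val_inj ->]]] //|].
by move=> uv; exists u; apply/existsP; exists v; rewrite !eqxx.
Qed.

Lemma pref_queryE v (x y : activity p) k l :
    alternative n p (x, k) -> alternative n p (y, l) ->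
  pref_query I v (code x) k (code y) l = pref I v (x, k) (y, l).
Proof.
move=> xk yl; apply/existsP/idP; last first.
  move=> H; exists v; apply/existsP; exists x; apply/existsP; exists y.
  by rewrite !eqxx xk yl.
move=> [z /existsP[x' /existsP[y']]].
by case/and5P=> /eqP/val_inj -> /eqP/code_inj -> /eqP/code_inj -> _ /andP[].
Qed.

(** Preference queries are meaningful on alternatives only. *)
Lemma outcome_alt T v : alternative n p (outcome T v).
Proof.
rewrite /alternative /outcome /coalition; case Tv: (T v) => [a|] /=.
  apply/andP; split; first by apply/card_gt0P; exists v; rewrite inE Tv.
  by rewrite -[X in _ <= X]card_ord max_card.
by rewrite cards1.
Qed.

Definition holds s b L := forall v, arr s b v = code (L v).

(* Array [a_rej] only records the rejections for the current activity. *)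
Definition rep a (st : state n p) s : Prop :=
  [/\ holds s a_lab st.1.1,
      forall v, arr s a_rej v = ((a, v) \in st.1.2),
      reg s r_more = isSome st.2 &
      forall N, st.2 = Some N -> holds s a_next N].

Lemma wp_visit T a v st s :
    reg s r_n = n -> reg s r_a = a -> reg s r_v = v -> holds s a_cur T ->
    rep a st s ->
  wp I visit s (rep a (follow I T st (a, v))).
Proof.
move: st => [[L R] N] sn sa sv sT [/= sL sR sN sX].
apply: wp_seq; apply: (@wp_any _ _ _ n (fun u => L u == Some a)) => //.
  move=> u s1 F1 s1u /=.
  by rewrite s1u (F1.2 1) // sL (F1.1 5) // sa code_eqS.
move=> s1 F1 s1ne.
apply: wp_seq; apply: (@wp_any _ _ _ n
    (fun u => (u \in players_of L a) && edge I u v)) => //.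
- by rewrite (F1.1 0).
- move=> u s2 F2 s2u; apply: eval_and => /=.
    rewrite s2u (F2.2 1) // (F1.2 1) // sL (F2.1 5) // (F1.1 5) // sa.
    by rewrite code_eqS inE.
  by rewrite s2u (F2.1 7) // (F1.1 7) // sv edge_queryE.
move=> s2 F2 s2adj.
have r2 x : x \in [:: 0; 5; 7] -> reg s2 x = reg s x.
  by rewrite !inE => /or3P[] /eqP ->; rewrite (F2.1 _) // (F1.1 _).
have a2 b : arr s2 b = arr s b by rewrite (F2.2 _) // (F1.2 _).
have r9 : reg s2 9 = (players_of L a != set0).
  rewrite (F2.1 9) // s1ne; congr nat_of_bool; apply/existsP/set0Pn => -[u].
    by move=> Lu; exists u; rewrite inE.
  by rewrite inE => Lu; exists u.
apply: (@wp_if _ _ _ _ _ _ _ (open I L R (a, v))).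
  rewrite /open; apply: eval_and; last apply: eval_and; rewrite /=.
  - by rewrite a2 r2 // sv sL code_eq0.
  - by rewrite a2 r2 // sv sR; case: (_ \in _).
  - by rewrite r9 s2adj; move: (_ == set0) [exists _, _] => [] [].
- move=> op; apply: (@wp_if _ _ _ _ _ _ _ (T v == Some a)).
  + by rewrite /= a2 !r2 // sv sT sa code_eqS.
  + move=> Tv; apply: wp_put; split; rewrite /follow op /= Tv /=.
    * move=> u; rewrite /= a2 !r2 // sv sa ffunE /= val_eqE.
      by case: eqP => //= _; apply: sL.
    * by move=> u; rewrite /= a2 sR.
    * by rewrite (F2.1 4) // (F1.1 4).
    * by move=> X /sX NX u; rewrite /= a2; apply: NX.
  + move=> Tv; apply: wp_seq; apply: wp_put; apply: wp_seq; apply: wp_set.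
    apply: wp_seq.
    apply: (@wp_map _ _ _ n (fun u => code (L u))) => //.
      by rewrite /= r2.
      by move=> u s3 F3 s3u; rewrite /= s3u (F3.2 1) //= a2 sL.
    move=> s3 F3 s3X; apply: wp_put; split; rewrite /follow op /= (negPf Tv) /=.
    * by move=> u; rewrite /= (F3.2 1) //= a2 sL.
    * move=> u; rewrite /= (F3.2 2) //= r2 // sv a2 in_setU1 val_eqE.
      by rewrite xpair_eqE eqxx /=; case: eqP => //= _; rewrite sR.
    * by rewrite (F3.1 4).
    * move=> _ [<-] u; rewrite /= (F3.1 7) // (F3.1 5) //= !r2 // sv sa.
      by rewrite ffunE /= val_eqE; case: eqP.
- by move=> nop; apply: wp_skip; split; rewrite /follow (negPf nop) //=;
    [move=> u; rewrite a2 sL|move=> u; rewrite a2 sR|rewrite (F2.1 4) // (F1.1 4)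
    |move=> X /sX NX u; rewrite a2; apply: NX].
Qed.

Lemma wp_replay T s :
    reg s r_n = n -> reg s r_p = p -> holds s a_cur T ->
    let N := (foldl (follow I T) (all_void n p, set0, None) (slots n p)).2 in
  wp I replay s (fun s' =>
    reg s' r_more = isSome N /\ forall X, N = Some X -> holds s' a_next X).
Proof.
move=> sn sp sT N; apply: wp_seq; apply: (@wp_map _ _ _ n (fun=> 0)) => //.
move=> s1 F1 s1L; apply: wp_seq; apply: wp_set => /=.
set s2 := set_reg _ _ _.
pose st k : state n p := foldl (fun st a => foldl (follow I T) st (block n a))
  (all_void n p, set0, None) (take k (enum 'I_p)).
(* By the clause on rejections, none concerns activity [k] or a later one; hence the freshly cleared
   [a_rej] represents the rejections for activity [k]. *)
apply: (@wp_for _ _ _ p _ _ _ _ (fun k s' =>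
  [/\ holds s' a_lab (st k).1.1,
      forall a v, (a, v) \in (st k).1.2 -> a < k,
      reg s' r_more = isSome (st k).2 &
      forall X, (st k).2 = Some X -> holds s' a_next X])) => //.
- by rewrite /s2 /= (F1.1 1).
- rewrite /st take0; split=> //=; first by move=> v; rewrite s1L ffunE.
  by move=> a v; rewrite inE.
- move=> a s3 F3 s3a [sL sR sN sX].
  have stS : st a.+1 = foldl (follow I T) (st a) (block n a).
    by rewrite /st take_enumS -cats1 foldl_cat.
  have s3n : reg s3 0 = n by rewrite (F3.1 0) //= (F1.1 0).
  have s3T : holds s3 0 T.
    by move=> v; rewrite (F3.2 0) //= (F1.2 0).
  apply: wp_seq; apply: (@wp_map _ _ _ n (fun=> 0)) => //.
  move=> s4 F4 s4R.
  have R4 : rep a (st a) s4.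
    split=> [v|v||X /sX NX v].
    + by rewrite (F4.2 1) // sL.
    + rewrite s4R; case E: (_ \in _) => //.
      by have := sR _ _ E; rewrite ltnn.
    + by rewrite (F4.1 4).
    + by rewrite (F4.2 3) // NX.
  have sub : forall a' v, (a', v) \in (st a.+1).1.2 -> a' < a.+1.
    move=> a' v; rewrite stS => /foldl_rejected[/sR/ltnW //|/mem_block /= ->].
    exact: ltnSn.
  apply: wp_conseq.
    apply: (@wp_for_fold _ _ _ n _
      (fun z _ => foldl (follow I T) z (sweep n a)) (rep a) (st a)
      _ _ _ _ (rep a (st a.+1))) => //.
    + by rewrite (F4.1 0).
    + move=> i z s5 F5 s5i R5.
      apply: (@wp_for_fold _ _ _ n _ (fun z v => follow I T z (a, v))
        (rep a) z) => //.
      * by rewrite (F5.1 0) // (F4.1 0).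
      * move=> v z' s6 F6 s6v R6; apply: wp_visit => //.
        - by rewrite (F6.1 0) // (F5.1 0) // (F4.1 0).
        - by rewrite (F6.1 5) // (F5.1 5) // (F4.1 5).
        - by move=> w; rewrite (F6.2 0) // (F5.2 0) // (F4.2 0).
      * by move=> s6 _; rewrite /sweep (foldl_map _ (pair a)).
    + by move=> s5 _; rewrite stS /block foldl_flatten (foldl_map _ (fun=> sweep n a)).
  move=> s5 _ [sL5 _ sN5 sX5]; split=> //.
move=> s3 F3 [_ _ sN sX].
rewrite /N /slots foldl_flatten foldl_map.
by move: sN sX; rewrite /st take_oversize ?size_enum_ord.
Qed.

Lemma wp_sizes T s :
    reg s r_n = n -> holds s a_cur T ->
  wp I sizes s (fun s' => forall v, arr s' a_size v = (outcome T v).2).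
Proof.
move=> sn sT.
apply: (@wp_for _ _ _ n _ _ _ _
  (fun k s' => forall v, v < k -> arr s' 4 v = (outcome T v).2)) => //; last first.
  by move=> s1 _ H v; apply: H.
move=> v s1 F1 s1v s1S.
have s1T u : arr s1 0 u = code (T u) by rewrite (F1.2 0).
have upd s2 k : (forall u, u < v -> arr s2 4 u = arr s1 4 u) ->
    reg s2 7 = v -> k = (outcome T v).2 ->
    forall u, u < v.+1 -> arr (set_arr s2 4 (reg s2 7) k) 4 u = (outcome T u).2.
  move=> s21 s2v -> u; rewrite /= s2v ltnS leq_eqVlt.
  case: eqP => [/val_inj -> //|_ /= uv]; by rewrite s21 // s1S.
apply: (@wp_if _ _ _ _ _ _ _ (T v == None)).
- by rewrite /= s1v s1T code_eq0.
- move=> /eqP Tv; apply: wp_put; apply: upd => //.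
  by rewrite /outcome /coalition Tv /= cards1.
- move=> Tv; apply: wp_seq.
  apply: (@wp_count _ _ _ n [set u | T u == T v]) => //.
  + by rewrite (F1.1 0).
  + move=> u s2 F2 s2u; rewrite /= s2u (F2.1 7) // s1v (F2.2 0) // !s1T.
    by rewrite code_eq inE.
  + move=> s2 F2 s2c; apply: wp_put; apply: upd => //.
    * by move=> u _; rewrite (F2.2 4).
    * by rewrite (F2.1 7).
    * by rewrite /= s2c /outcome /coalition /=; case: (T v) Tv.
Qed.

Lemma wp_closing P r s :
    reg s r_n = n -> reg s r_root = r ->
    (forall v, arr s a_eager v = (v \in P)) ->
  wp I closing s (fun s' =>
    forall v, arr s' a_clos v = (v \in reach I P r)).
Proof.
move=> sn sr sP; apply: wp_seq.
apply: (@wp_map _ _ _ n (fun v => (v \in P :&: [set r]) : nat)) => //.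
  move=> v s1 F1 s1v; rewrite inE; apply: eval_and => /=.
    by rewrite s1v (F1.2 5) // sP.
  by rewrite s1v (F1.1 12) // sr val_eqE inE.
move=> s1 F1 s1D.
pose Rep D s' := forall v, arr s' 6 v = (v \in D).
apply: (@wp_for_fold _ _ _ n _
  (fun D _ => foldl (absorb I P) D (enum 'I_n)) Rep (P :&: [set r])) => //.
  by rewrite (F1.1 0).
move=> i D s2 F2 _ s2D.
apply: (@wp_for_fold _ _ _ n _ (absorb I P) Rep D) => //.
  by rewrite (F2.1 0) // (F1.1 0).
move=> v D' s3 F3 s3v s3D.
apply: wp_seq.
apply: (@wp_any _ _ _ n (fun u => (u \in D') && edge I u v)) => //.
- by rewrite (F3.1 0) // (F2.1 0) // (F1.1 0).
- move=> u s4 F4 s4u; apply: eval_and => /=.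
    by rewrite s4u (F4.2 6) // s3D.
  by rewrite s4u (F4.1 7) // s3v edge_queryE.
move=> s4 F4 s4J.
have s4v : reg s4 7 = v by rewrite (F4.1 7).
apply: (@wp_if _ _ _ _ _ _ _ ((v \in P) && [exists u in D', edge I u v])).
- apply: eval_and => //=.
  by rewrite s4v (F4.2 5) // (F3.2 5) // (F2.2 5) // (F1.2 5) // sP.
- move=> H; apply: wp_put => u; rewrite /absorb H /= s4v in_setU1 val_eqE.
  by case: eqP => //= _; rewrite (F4.2 6) // s3D.
- move=> H; apply: wp_skip => u.
  by rewrite /absorb (negPf H) (F4.2 6) // s3D.
Qed.

Lemma wp_try_root T a (k : 'I_n) r s (b : bool) :
    reg s r_n = n -> reg s r_a = a -> reg s r_k = k -> reg s r_root = r ->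
    holds s a_cur T ->
    (forall v, arr s a_eager v = (v \in eager I T a k.+1)) ->
    reg s r_bad = b ->
  wp I try_root s (fun s' => reg s' r_bad = b || blocked_from I T a k.+1 r).
Proof.
move=> sn sa sk sr sT sP sb; set D := reach I (eager I T a k.+1) r.
apply: wp_seq; apply: wp_conseq (wp_closing sn sr sP) _ => s1 F1; rewrite -/D => s1D.
apply: wp_seq; apply: (@wp_count _ _ _ n D) => //.
  by rewrite (F1.1 0).
  by move=> v s2 F2 s2v; rewrite /= s2v (F2.2 6) // s1D.
move=> s2 F2 s2c.
apply: wp_seq; apply: (@wp_count _ _ _ n (players_of T a)) => //.
  by rewrite (F2.1 0) // (F1.1 0).
  move=> v s3 F3 s3v.
  rewrite /= s3v (F3.2 0) // (F2.2 0) // (F1.2 0) // sT (F3.1 5) //.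
  by rewrite (F2.1 5) // (F1.1 5) // sa code_eqS inE.
move=> s3 F3 s3m.
apply: wp_seq; apply: (@wp_any _ _ _ n
  (fun v => (v \in players_of T a) && (v \notin D))) => //.
- by rewrite (F3.1 0) // (F2.1 0) // (F1.1 0).
- move=> v s4 F4 s4v; apply: eval_and; last apply: eval_not; rewrite /= s4v.
    rewrite (F4.2 0) // (F3.2 0) // (F2.2 0) // (F1.2 0) // sT (F4.1 5) //.
    by rewrite (F3.1 5) // (F2.1 5) // (F1.1 5) // sa code_eqS inE.
  by rewrite (F4.2 6) // (F3.2 6) // (F2.2 6) // s1D.
move=> s4 F4 s4o.
have s4b : reg s4 11 = b by rewrite (F4.1 11) // (F3.1 11) // (F2.1 11) // (F1.1 11).
have s4k : reg s4 6 = k by rewrite (F4.1 6) // (F3.1 6) // (F2.1 6) // (F1.1 6).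
apply: (@wp_if _ _ _ _ _ _ _ (blocked_from I T a k.+1 r)).
- rewrite /blocked_from -/D; apply: eval_and; last apply: eval_and.
  + have -> : (players_of T a \subset D) =
        ~~ [exists v, (v \in players_of T a) && (v \notin D)].
      apply/subsetP/existsPn => [TD v|TD v vT].
        by apply/negP => /andP[/TD ->].
      by have := TD v; rewrite vT /= negbK.
    exact: eval_not.
  + by rewrite /= s4k (F4.1 14) // (F3.1 14) // s2c.
  + by rewrite /= s4k (F4.1 15) // s3m ltnS.
- by move=> H; apply: wp_set; rewrite /= H orbT.
- by move=> H; apply: wp_skip; rewrite (negPf H) orbF.
Qed.

Lemma wp_test T s :
    reg s r_n = n -> reg s r_p = p -> holds s a_cur T ->
  wp I test s (fun s' => reg s' r_bad = ~~ stable I T).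
Proof.
move=> sn sp sT; rewrite /stable negbK.
apply: wp_seq; apply: wp_conseq (wp_sizes sn sT) _ => s1 F1 s1S.
apply: wp_seq; apply: (@wp_any _ _ _ n
  (fun v => ~~ pref I v (outcome T v) (None, 1))) => //.
- by rewrite (F1.1 0).
- move=> v s2 F2 s2v; apply: eval_not => /=.
  rewrite s2v (F2.2 0) // (F1.2 0) // sT (F2.2 4) // s1S.
  by rewrite (@pref_queryE v (T v) None) ?outcome_alt.
move=> s2 F2 s2b.
apply: (@wp_for_or _ _ _ p (fun a => [exists k : 'I_n, exists r,
  blocked_from I T a k.+1 r]) 11 (irrational I T)) => //.
  by rewrite (F2.1 1) // (F1.1 1).
move=> a z s3 F3 s3a s3b.
apply: (@wp_for_or _ _ _ n (fun k => [exists r, blocked_from I T a k.+1 r])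
  11 z) => //.
  by rewrite (F3.1 0) // (F2.1 0) // (F1.1 0).
move=> k z' s4 F4 s4k s4b.
have s4T : holds s4 0 T.
  by move=> v; rewrite (F4.2 0) // (F3.2 0) // (F2.2 0) // (F1.2 0).
have s4n : reg s4 0 = n.
  by rewrite (F4.1 0) // (F3.1 0) // (F2.1 0) // (F1.1 0).
have s4a : reg s4 5 = a by rewrite (F4.1 5).
have s4S v : arr s4 4 v = (outcome T v).2.
  by rewrite (F4.2 4) // (F3.2 4) // (F2.2 4) // s1S.
apply: wp_seq.
apply: (@wp_map _ _ _ n (fun v => (v \in eager I T a k.+1) : nat)) => //.
  move=> v s5 F5 s5v; rewrite inE; apply: eval_and; last apply: eval_not.
    rewrite /= s5v (F5.1 5) // s4a (F5.1 6) // s4k (F5.2 0) // s4T (F5.2 4) //.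
    rewrite s4S (@pref_queryE v (Some a) (T v)) ?outcome_alt //.
    by rewrite /alternative /=.
  rewrite /= s5v (F5.1 5) // s4a (F5.1 6) // s4k (F5.2 0) // s4T (F5.2 4) //.
  rewrite s4S (@pref_queryE v (T v) (Some a)) ?outcome_alt //.
  by rewrite /alternative /=.
move=> s5 F5 s5P.
apply: (@wp_for_or _ _ _ n (fun r => blocked_from I T a k.+1 r) 11 z') => //.
- by rewrite (F5.1 0).
- by rewrite (F5.1 11).
- move=> r z'' s6 F6 s6r s6b; apply: wp_try_root => //.
  + by rewrite (F6.1 0) // (F5.1 0).
  + by rewrite (F6.1 5) // (F5.1 5).
  + by rewrite (F6.1 6) // (F5.1 6).
  + by move=> v; rewrite (F6.2 0) // (F5.2 0).
  + by move=> v; rewrite (F6.2 5) // s5P.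
Qed.

Lemma wp_round T s :
    reg s r_n = n -> reg s r_p = p -> reg s r_found = 0 -> reg s r_go = 1 ->
    holds s a_cur T ->
    let N := (foldl (follow I T) (all_void n p, set0, None) (slots n p)).2 in
  wp I round s (fun s' =>
    [/\ reg s' r_found = stable I T,
        reg s' r_go = ~~ stable I T && isSome N &
        holds s' a_cur (if stable I T then T else odflt T N)]).
Proof.
move=> sn sp sF sG sT N.
apply: wp_seq; apply: wp_conseq (wp_replay sn sp sT) _ => s1 F1 [].
rewrite -/N => s1M s1X.
have s1T : holds s1 0 T by move=> v; rewrite (F1.2 0).
have s1n : reg s1 0 = n by rewrite (F1.1 0).
have s1p : reg s1 1 = p by rewrite (F1.1 1).
apply: wp_seq; apply: wp_conseq (wp_test s1n s1p s1T) _ => s2 F2 s2B.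
have s2T : holds s2 0 T by move=> v; rewrite (F2.2 0).
have s2F : reg s2 2 = 0 by rewrite (F2.1 2) // (F1.1 2).
have s2G : reg s2 3 = 1 by rewrite (F2.1 3) // (F1.1 3).
apply: (@wp_if _ _ _ _ _ _ _ (~~ stable I T)) => // St; last first.
  have {}St : stable I T := negbNE St.
  by rewrite St; apply: wp_seq; apply: wp_set; apply: wp_set; split.
rewrite (negPf St); apply: (@wp_if _ _ _ _ _ _ _ (isSome N)).
- by rewrite /= (F2.1 4).
- case EN: N => [X|] // _.
  apply: (@wp_map _ _ _ n (fun v => code (X v))) => //.
  + by rewrite (F2.1 0).
  + by move=> v s3 F3 s3v; rewrite /= s3v (F3.2 3) // (F2.2 3) // (s1X X).
  + by move=> s3 F3 s3X; split; rewrite ?(F3.1 2) ?(F3.1 3).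
- by case EN: N => [X|] // _; apply: wp_set.
Qed.

(** The main loop escapes [wp], which would charge it only [n + p] iterations. It is analysed by
    induction on the number of leaves left; each evaluation of its guard costs 2. *)
Lemma rounds k s :
    let Ts := leaves I (all_void n p) set0 (slots n p) in
    k < size Ts ->
    reg s r_n = n -> reg s r_p = p -> reg s r_found = 0 -> reg s r_go = 1 ->
    holds s a_cur (nth (all_void n p) Ts k) ->
  exists t s', [/\ exec I (CWhile (EReg r_go) round) s t s',
    t <= (size Ts - k) * (2 + cost (n + p) round) + 2 &
    (reg s' r_found = 1 /\
       exists T, [/\ T \in Ts, stable I T & holds s' a_cur T]) \/
    (reg s' r_found = 0 /\
       forall i, k <= i < size Ts -> ~~ stable I (nth (all_void n p) Ts i))].
Proof.
move=> Ts kT sn sp sF sG; move Ej: (size Ts - k) => j.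
elim: j k s kT Ej sn sp sF sG => [|j IHj] k s kT Ej sn sp sF sG; first by lia.
set T := nth _ Ts k => sT; have TTs : T \in Ts by apply: mem_nth.
have [t1 [s1 [H1 c1 [[]]]]] := wp_conseq (wp_round sn sp sF sG sT)
  (Q := fun s' => _ /\ frame round s s') (fun s' F H => conj H F).
(* As the leaves are distinct, the successor of the leaf at index [k] is the one at [k.+1]. *)
rewrite follow_next // -/Ts index_uniq ?leaves_uniq // => s1F s1G s1T F1.
have stop : reg s1 3 = 0 -> exec I (CWhile (EReg 3) round) s (2 + t1 + 2) s1.
  move=> s10; apply: exec_while_true H1 _; first by rewrite /= sG.
  exact: exec_while_false.
have [St|St] := boolP (stable I T).
  rewrite St in s1F s1G s1T.
  exists (2 + t1 + 2), s1; split; [exact: stop|lia|left; split=> //].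
  by exists T.
rewrite (negPf St) /= in s1F s1G s1T.
have [kS|kS] := ltnP k.+1 (size Ts); last first.
  rewrite nth_default ?size_map // in s1G.
  exists (2 + t1 + 2), s1; split; [exact: stop|lia|right; split=> //].
  by move=> i /andP[ki iT]; have -> : i = k by lia.
rewrite (nth_map (all_void n p)) // in s1G s1T.
have [|||t2 [s2 [H2 c2 R2]]] := IHj k.+1 s1 kS _ _ _ s1F s1G s1T.
- lia.
- by rewrite (F1.1 0).
- by rewrite (F1.1 1).
exists (2 + t1 + t2), s2; split.
- by apply: exec_while_true H1 H2; rewrite /= sG.
- lia.
- case: R2 => [|[s2F no]]; [by left|right; split=> // i].
  rewrite leq_eqVlt => /andP[/predU1P[<- //|ki] iT].
  by apply: no; rewrite ki.
Qed.

End Correctness.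

(** * Time bound and verdict *)

Theorem proposition21 :
  exists (prog : cmd) (C d : nat),
    forall (n p : nat) (I : gGASP n p), 0 < n ->
      exists (t : nat) (s : store),
        [/\ exec I prog (init_store n p) t s,
            t <= C * kappa I ^ p * (n + p) ^ d
          & solved I s].
Proof.
have [C [d Cd]] := cost_poly round.
(* The factor 4 and the exponent 3 come from the number of leaves, [C] and [d] from the cost of a
   round. The 8 pays 2 for the guard in each round and, there being at least one leaf, 6 for the
   final guard and the two outer assignments. *)
exists solver, (4 * (C + 8)), (3 + d) => n p I n0.
pose Ts := leaves I (all_void n p) set0 (slots n p).
have Ts0 : 0 < size Ts by apply: leaves_gt0.
have [|t [s [H ct R]]] :=
  @rounds n p I 0 (set_reg (init_store n p) 3 1) Ts0 erefl erefl erefl erefl.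
  by move=> v; rewrite leaves_head ffunE.
exists (2 + (t + 2)), (set_reg s 0 (reg s 2)); split.
- apply: exec_seq; first exact: (exec_set I _ 3 (EConst 1)).
  by apply: exec_seq H _; apply: (exec_set I s 0 (EReg 2)).
- have m0 : 0 < n + p by lia.
  have := Cd _ m0; have := card_feasible I n0.
  have := size_leaves I; rewrite -/Ts.
  move: ct; rewrite -/Ts subn0 expnD.
  have : 0 < (n + p) ^ d by rewrite expn_gt0 m0.
  set F := #|_|; set x := _ ^ 3; set y := _ ^ d; set K := _ ^ p.
  set c := cost _ _ => y0 ct TF Fx cy.
  have c8 : c + 8 <= (C + 8) * y by nia.
  have := leq_mul (leq_trans TF Fx) c8.
  have -> : 4 * K * x * ((C + 8) * y) = 4 * (C + 8) * K * (x * y) by nia.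
  by apply: leq_trans; nia.
- have feasT T : T \in Ts -> feasible I T.
    move=> TT; apply/feasibleP; apply: leaves_feasible TT.
    apply/forallP => a; have -> : players_of (all_void n p) a = set0.
      by apply/setP => v; rewrite !inE ffunE.
    exact: connected0.
  case: R => [[sF [T [TT St sT]]]|[sF no]]; [left|right]; split=> //.
    by exists T; split=> //; apply/stableP => //; apply: feasT.
  (* A core stable assignment is feasible, hence a leaf, and every leaf has been tested and found
     not stable. *)
  move=> [T Tc]; have Tf : feasible I T by case: Tc.
  have TT : T \in Ts by apply: mem_leaves; apply/feasibleP.
  have := no (index T Ts); rewrite index_mem TT nth_index // => /(_ isT).
  by move/negP; apply; apply/stableP.
Qed.
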